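(* Let $\Gamma \subset \mathrm{PSL}(2,\mathbb{R})$ be a geometrically-finite Fuchsian group acting on the upper half plane $\mathbb{H}$, and let $\mathcal{E}\subset\mathbb{H}$ denote the set of elliptic fixed points of $\Gamma$ in $\mathbb{H}$. Let $l_0$ be the length of the smallest closed geodesic on $\Gamma\backslash\mathbb{H}$. Let $z,w\in\mathcal{E}$, $z\neq w$, be chosen so that the hyperbolic distance $\rho(z,w)$ is minimal among all pairs of distinct points of $\mathcal{E}$. Then $$\rho(z,w)\;\geq\;\min\left\{\tfrac{l_0}{2},\ \kappa\right\},$$ where $$\kappa=\sinh^{-1}\!\left(\tfrac{2}{\sqrt{3}}\,C\right)=0.151\dots,\qquad C=\left(\frac{4\cos^{2}(\pi/7)-3}{8\cos(\pi/7)+7}\right)^{1/2}=0.1318\dots.$$ Moreover, if all elliptic fixed points of $\Gamma$ have order greater than two, then the term $\tfrac{l_0}{2}$ can be omitted, i.e. $\rho(z,w)\geq\kappa$.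
   Context: $\mathbb{H}=\{x+iy : y>0\}$ carries the hyperbolic metric $ds^2=(dx^2+dy^2)/y^2$, with distance $\rho$; $\mathrm{PSL}(2,\mathbb{R})$ acts on $\mathbb{H}$ by Möbius transformations. A Fuchsian group is a discrete subgroup of $\mathrm{PSL}(2,\mathbb{R})$; geometrically finite is meant in the standard sense (Beardon, Katok). An elliptic element is a nontrivial element of $\mathrm{PSL}(2,\mathbb{R})$ having a (necessarily unique) fixed point in $\mathbb{H}$; an elliptic fixed point of $\Gamma$ is a point of $\mathbb{H}$ fixed by some elliptic element of $\Gamma$. The order of $z\in\mathcal{E}$ is the order of its stabilizer $\Gamma_z$, which is a finite cyclic group. A hyperbolic element $\alpha$ is one conjugate in $\mathrm{PSL}(2,\mathbb{R})$ to $z\mapsto kz$ with $k>1$; its translation length is $T_\alpha=\ln k=\inf_{z\in\mathbb{H}}\rho(z,\alpha z)$. The image in $\Gamma\backslash\mathbb{H}$ of the axis of a hyperbolic $\alpha\in\Gamma$ is regarded as a closed geodesic of length $T_\alpha$; thus $l_0$ is the minimum of $T_\alpha$ over hyperbolic $\alpha\in\Gamma$ (if $\Gamma$ has no hyperbolic elements, $l_0=+\infty$). *)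

(* Defs.v *)
From HB Require Import structures.
From mathcomp Require Import all_boot all_order all_algebra.
From mathcomp Require Import finmap generic_quotient complex.
From mathcomp Require Import all_classical all_reals all_analysis.
From mathcomp Require Import ring.

Set Implicit Arguments.
Unset Strict Implicit.
Unset Printing Implicit Defensive.

Import Order.TTheory GRing.Theory Num.Theory.
Import numFieldNormedType.Exports.

Local Open Scope classical_set_scope.
Local Open Scope ring_scope.
Local Open Scope complex_scope.
Local Open Scope quotient_scope.

Record SL2 (R : realType) := MkSL2 {
  SL2_mx :> 'M[R]_2;
  SL2_det : \det SL2_mx == 1 }.

HB.instance Definition _ (R : realType) := [isSub for @SL2_mx R].
HB.instance Definition _ (R : realType) := [Choice of SL2 R by <:].
HB.instance Definition _ (R : realType) :=
  Topological.copy (SL2 R) (initial_topology (@SL2_mx R)).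

Section SL2_group.
Variable R : realType.
Implicit Types A B C : SL2 R.

Fact SL2_one_subproof : \det (1%:M : 'M[R]_2) == 1.
Proof. by rewrite det1. Qed.
Definition SL2_one := MkSL2 SL2_one_subproof.

Fact SL2_mul_subproof A B : \det (SL2_mx A *m SL2_mx B) == 1.
Proof. by rewrite det_mulmx (eqP (SL2_det A)) (eqP (SL2_det B)) mulr1. Qed.
Definition SL2_mul A B := MkSL2 (SL2_mul_subproof A B).

Fact SL2_unit A : SL2_mx A \in unitmx.
Proof. by rewrite unitmxE (eqP (SL2_det A)) unitr1. Qed.

Fact SL2_inv_subproof A : \det (invmx (SL2_mx A)) == 1.
Proof. by rewrite det_inv (eqP (SL2_det A)) invr1. Qed.
Definition SL2_inv A := MkSL2 (SL2_inv_subproof A).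

Fact SL2_mulA : associative SL2_mul.
Proof. by move=> A B C; apply: val_inj; rewrite /= mulmxA. Qed.
Fact SL2_mul1 : left_id SL2_one SL2_mul.
Proof. by move=> A; apply: val_inj; rewrite /= mul1mx. Qed.
Fact SL2_mulr1 : right_id SL2_one SL2_mul.
Proof. by move=> A; apply: val_inj; rewrite /= mulmx1. Qed.
Fact SL2_mulV : left_inverse SL2_one SL2_inv SL2_mul.
Proof. by move=> A; apply: val_inj; rewrite /= mulVmx ?SL2_unit. Qed.
Fact SL2_mulVr : right_inverse SL2_one SL2_inv SL2_mul.
Proof. by move=> A; apply: val_inj; rewrite /= mulmxV ?SL2_unit. Qed.

HB.instance Definition _ := isGroup.Build (SL2 R)
  SL2_mulA SL2_mul1 SL2_mulr1 SL2_mulV SL2_mulVr.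

End SL2_group.

Section PSL2.
Variable R : realType.
Implicit Types A B C : SL2 R.

Definition eqpm A B : bool :=
  (SL2_mx A == SL2_mx B) || (SL2_mx A == - SL2_mx B).

Fact eqpm_refl : reflexive eqpm.
Proof. by move=> A; rewrite /eqpm eqxx. Qed.
Fact eqpm_sym : symmetric eqpm.
Proof.
by move=> A B; rewrite /eqpm [SL2_mx B == _]eq_sym [SL2_mx B == - _]eq_sym eqr_oppLR.
Qed.
Fact eqpm_trans : transitive eqpm.
Proof.
move=> B A C; rewrite /eqpm.
move=> /orP[]/eqP-> /orP[]/eqP->; by rewrite ?opprK eqxx ?orbT.
Qed.

Canonical eqpm_equiv := EquivRel eqpm eqpm_refl eqpm_sym eqpm_trans.

(* Quotient of SL(2,R) by +-1, with the quotient topology. *)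
Definition PSL2 := quotient_topology {eq_quot eqpm_equiv}.
HB.instance Definition _ := Quotient.on PSL2.
HB.instance Definition _ := Choice.on PSL2.

Definition toPSL2 A : PSL2 := \pi_PSL2 A.

Lemma toPSL2_eq A B : toPSL2 A = toPSL2 B <-> eqpm A B.
Proof. by split=> [/eqquotP|?]; last exact/eqquotP. Qed.

Lemma eqpm_repr A : eqpm (repr (toPSL2 A)) A.
Proof. by apply/toPSL2_eq; rewrite /toPSL2 reprK. Qed.

Definition PSL2_one : PSL2 := toPSL2 1%g.
Definition PSL2_mul (g h : PSL2) : PSL2 := toPSL2 (repr g * repr h)%g.
Definition PSL2_inv (g : PSL2) : PSL2 := toPSL2 (repr g)^-1%g.

Lemma toPSL2M A B : PSL2_mul (toPSL2 A) (toPSL2 B) = toPSL2 (A * B)%g.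
Proof.
apply/toPSL2_eq; have := eqpm_repr A; have := eqpm_repr B; rewrite /eqpm /=.
move=> /orP[]/eqP-> /orP[]/eqP->;
  by rewrite ?(mulmxN, mulNmx) ?opprK eqxx ?orbT.
Qed.

Lemma toPSL2V A : PSL2_inv (toPSL2 A) = toPSL2 A^-1%g.
Proof.
have invN : invmx (- SL2_mx A) = - invmx A.
  rewrite -scaleN1r invmxZ ?invrN1 ?scaleN1r //.
  by rewrite unitmxE -scaleN1r detZ unitrM unitrX ?unitrN1 //= -unitmxE SL2_unit.
apply/toPSL2_eq; have := eqpm_repr A; rewrite /eqpm /=.
by move=> /orP[]/eqP->; rewrite ?invN eqxx ?orbT.
Qed.

Lemma toPSL2_ind (P : PSL2 -> Prop) : (forall A, P (toPSL2 A)) -> forall g, P g.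
Proof. by move=> PA g; rewrite -[g]reprK; exact: PA. Qed.

Fact PSL2_mulA : associative PSL2_mul.
Proof.
elim/toPSL2_ind=> A; elim/toPSL2_ind=> B; elim/toPSL2_ind=> C.
by rewrite !toPSL2M mulgA.
Qed.
Fact PSL2_mul1 : left_id PSL2_one PSL2_mul.
Proof. by elim/toPSL2_ind=> A; rewrite toPSL2M mul1g. Qed.
Fact PSL2_mulr1 : right_id PSL2_one PSL2_mul.
Proof. by elim/toPSL2_ind=> A; rewrite toPSL2M mulg1. Qed.
Fact PSL2_mulV : left_inverse PSL2_one PSL2_inv PSL2_mul.
Proof. by elim/toPSL2_ind=> A; rewrite toPSL2V toPSL2M mulVg. Qed.
Fact PSL2_mulVr : right_inverse PSL2_one PSL2_inv PSL2_mul.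
Proof. by elim/toPSL2_ind=> A; rewrite toPSL2V toPSL2M mulgV. Qed.

HB.instance Definition _ := isGroup.Build PSL2
  PSL2_mulA PSL2_mul1 PSL2_mulr1 PSL2_mulV PSL2_mulVr.

End PSL2.

Record UHP (R : realType) := MkUHP {
  UHP_val :> R[i];
  UHP_pos : 0 < complex.Im UHP_val }.

HB.instance Definition _ (R : realType) := [isSub for @UHP_val R].
HB.instance Definition _ (R : realType) := [Choice of UHP R by <:].
(* Euclidean topology, through the identification of R[i] with R * R. *)
HB.instance Definition _ (R : realType) := Topological.copy (UHP R)
  (initial_topology (fun z : UHP R => (complex.Re z, complex.Im z) : R * R)).

Section action.
Variable R : realType.
Implicit Types (A B : SL2 R) (z w : UHP R) (g h : PSL2 R).

Definition moebius_num A (z : R[i]) : R[i] := (A 0 0)%:C * z + (A 0 1)%:C.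
Definition moebius_den A (z : R[i]) : R[i] := (A 1 0)%:C * z + (A 1 1)%:C.
Definition moebius A (z : R[i]) : R[i] := moebius_num A z / moebius_den A z.

Lemma SL2_detE A : A 0 0 * A 1 1 - A 0 1 * A 1 0 = 1.
Proof. have /eqP <- := SL2_det A.
rewrite (expand_det_row _ 0) !big_ord_recl big_ord0 /cofactor !det_mx11 !mxE /=.
rewrite expr0 expr1 mul1r mulN1r addr0 mulrN /=.
by congr (_ * _ - _ * _); congr (SL2_mx A _ _); apply/val_inj. Qed.

Lemma moebius_den_neq0 A z : moebius_den A z != 0.
Proof.
have dA := SL2_detE A; case: z => -[x y] /= y0.
apply/negP; rewrite /moebius_den eq_complex /= !mul0r subr0 !addr0.
move=> /andP[/eqP re0 /eqP im0]; move: im0 re0 dA => /eqP.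
rewrite mulf_eq0 (gt_eqF y0) orbF => /eqP ->; rewrite mul0r add0r => ->.
by rewrite !mulr0 subr0 => /eqP; rewrite eq_sym oner_eq0.
Qed.

Lemma Im_moebius A z :
  complex.Im (moebius A z) =
  complex.Im z /
  (complex.Re (moebius_den A z) ^+ 2 + complex.Im (moebius_den A z) ^+ 2).
Proof.
have := SL2_detE A; case: z => -[x y] /= y0 dA.
rewrite /moebius /moebius_num /moebius_den /= !mul0r !subr0 !addr0.
set d := (_ + _ : R)^-1.
have -> : y * d = y * d * (A 0 0 * A 1 1 - A 0 1 * A 1 0) by rewrite dA mulr1.
ring.
Qed.

Fact moebius_pos A z : 0 < complex.Im (moebius A z).
Proof.
rewrite Im_moebius divr_gt0 ?UHP_pos// lt_neqAle addr_ge0 ?sqr_ge0// andbT.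
rewrite eq_sym paddr_eq0 ?sqr_ge0// !sqrf_eq0.
by have := moebius_den_neq0 A z; rewrite eq_complex.
Qed.

Definition SL2_act A z : UHP R := MkUHP (moebius_pos A z).

(* Independent of the representative, see PSL2_actE. *)
Definition PSL2_act g z : UHP R := SL2_act (repr g) z.

Lemma PSL2_actE A z : PSL2_act (toPSL2 A) z = SL2_act A z.
Proof.
apply: val_inj; rewrite /= /moebius /moebius_num /moebius_den.
have /orP[/eqP->//|/eqP->] := eqpm_repr A.
by rewrite !mxE !rmorphN /= !mulNr -!opprD invrN mulrNN.
Qed.

End action.

Section distance.
Variable R : realType.
Implicit Types (x y : R -> R) (z w p : UHP R).

Definition C1 (f : R -> R) := (forall t, derivable f t 1) /\ continuous (derive1 f).

(* t |-> x t + i (y t), for t in [0, 1], is a C^1 path in the upper half-plane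
   from z to w; every C^1 function on [0, 1] extends to a C^1 function on R. *)
Definition C1_path x y z w :=
  [/\ C1 x, C1 y, forall t, t \in `[0, 1] -> 0 < y t,
      x 0 +i* y 0 = UHP_val z & x 1 +i* y 1 = UHP_val w].

(* Length for the metric (dx^2 + dy^2) / y^2. *)
Definition hyp_length x y : R :=
  \int[lebesgue_measure]_(t in `[0, 1])
    (Num.sqrt (derive1 x t ^+ 2 + derive1 y t ^+ 2) / y t).

Definition rho z w : R :=
  inf [set L | exists x y, C1_path x y z w /\ L = hyp_length x y].

(* The geodesic segment joining z to w. *)
Definition hyp_segment z w : set (UHP R) :=
  [set p | rho z p + rho p w = rho z w].

Definition hyp_convex (P : set (UHP R)) :=
  forall z w, P z -> P w -> hyp_segment z w `<=` P.

End distance.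

Section Fuchsian.
Variable R : realType.
Implicit Types (G : set (PSL2 R)) (P : set (UHP R)) (g h a : PSL2 R).
Implicit Types z w : UHP R.

Definition is_subgroup G :=
  [/\ G 1%g, forall g h, G g -> G h -> G (g * h)%g
    & forall g, G g -> G (g^-1)%g].

Definition Fuchsian G := is_subgroup G /\ G `<=` isolated G.

(* A convex, locally finite fundamental domain. The requirement that the
   boundary have zero area, sometimes added, is automatic by convexity. *)
Definition convex_fundamental_polygon G P :=
  [/\ open P, P !=set0, hyp_convex P &
  [/\ forall g, G g -> g <> 1%g -> P `&` (PSL2_act g @` P) = set0,
      \bigcup_(g in G) (PSL2_act g @` closure P) = setT
    & forall K : set (UHP R), compact K ->
        finite_set [set g | G g /\ K `&` (PSL2_act g @` closure P) !=set0]]].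

(* By convexity and disjointness of the translates of P, the intersection of
   closure P with another translate is a geodesic segment, possibly empty or
   reduced to a point; the sides are those of positive length. *)
Definition polygon_sides G P : set (set (UHP R)) :=
  [set S | exists g, [/\ G g, g <> 1%g,
                         S = closure P `&` (PSL2_act g @` closure P)
                       & exists z w, [/\ S z, S w & z <> w]]].

Definition geometrically_finite G :=
  exists P, convex_fundamental_polygon G P /\ finite_set (polygon_sides G P).

Definition elliptic g := g <> 1%g /\ exists z, PSL2_act g z = z.

Definition elliptic_points G : set (UHP R) :=
  [set z | exists g, [/\ G g, elliptic g & PSL2_act g z = z]].

Definition stabilizer G z : set (PSL2 R) :=
  [set g | G g /\ PSL2_act g z = z].

(* Stabilizers are finite when G is Fuchsian; fset_set is empty on infinite
   sets. *)
Definition point_order G z : nat := #|` fset_set (stabilizer G z)|.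

(* a is hyperbolic, conjugate to d : z |-> k z with k > 1, and T = ln k. *)
Definition translation_length a (T : R) :=
  exists k h d, [/\ 1 < k, forall z, UHP_val (PSL2_act d z) = k%:C * UHP_val z,
                    a = (h * d * h^-1)%g & T = ln k].

(* The infimum is over the empty set, hence +oo, when G has no hyperbolic
   element; otherwise it is a minimum when G is geometrically finite. *)
Definition systole G : \bar R :=
  ereal_inf [set T%:E | T in
    [set T | exists2 a, G a & translation_length a T]].

Definition closest_elliptic_pair G z w :=
  [/\ elliptic_points G z, elliptic_points G w, z <> w &
      forall z' w', elliptic_points G z' -> elliptic_points G w' -> z' <> w' ->
        rho z w <= rho z' w'].

End Fuchsian.

Section constants.
Variable R : realType.

Definition sinh (x : R) : R := (expR x - expR (- x)) / 2.

Definition arsinh (x : R) : R := ln (x + Num.sqrt (x ^+ 2 + 1)).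

Lemma arsinhK : cancel arsinh sinh.
Proof.
move=> x; rewrite /sinh /arsinh expRN.
have s_ge0 : 0 <= x ^+ 2 + 1 by rewrite addr_ge0 ?sqr_ge0.
set s := Num.sqrt _.
have sE : s ^+ 2 = x ^+ 2 + 1 by rewrite sqr_sqrtr.
have xs_gt0 : 0 < x + s.
  have : `|x| < s.
    by rewrite -sqrtr_sqr ltr_sqrt ?ltrDl // ltr_pwDr ?sqr_ge0.
  by rewrite ltr_norml => /andP[+ _]; rewrite -subr_gt0 opprK.
rewrite lnK ?posrE //.
have -> : (x + s)^-1 = s - x.
  apply: (mulfI (lt0r_neq0 xs_gt0)); rewrite divff ?lt0r_neq0 //.
  by rewrite [x + s]addrC mulrC -subr_sqr sE addrAC subrr add0r.
by field.
Qed.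

Lemma sinhK : cancel sinh arsinh.
Proof.
move=> x; rewrite /arsinh.
have e0 := expR_gt0 x; have e0' := expR_gt0 (- x).
have eE : expR x * expR (- x) = 1 by rewrite expRxMexpNx_1.
have -> : sinh x ^+ 2 + 1 = ((expR x + expR (- x)) / 2) ^+ 2.
  by rewrite -[X in _ + X = _]eE /sinh; field.
rewrite sqrtr_sqr ger0_norm ?divr_ge0 ?addr_ge0 ?ltW //.
by rewrite (_ : _ + _ = expR x) ?expRK // /sinh; field.
Qed.

(* The constant C with kappa = arsinh (2 C / sqrt 3). *)
Definition Cconst : R :=
  Num.sqrt ((4 * cos (pi / 7) ^+ 2 - 3) / (8 * cos (pi / 7) + 7)).

Definition kappa : R := arsinh (2 / Num.sqrt 3 * Cconst).

End constants.
Arguments Cconst : clear implicits.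
Arguments kappa : clear implicits.

(* Main.v *)
Require Import Defs.
From HB Require Import structures.
From mathcomp Require Import all_boot all_order all_algebra.
From mathcomp Require Import finmap complex.
From mathcomp Require Import all_classical all_reals all_analysis.
From mathcomp Require Import ring lra.

(* Write delta(z,w) = |z-w|^2 / (Im z Im w) = 4 sinh^2(rho(z,w)/2). The squared
   displacement delta(w, Mw) of M in SL(2,R) is quadratic in the traceless part
   of M, so that powers of M multiply it by the square of a Chebyshev polynomial
   of the trace. Let z, w be a closest pair, and delta = delta(z,w). Every M in
   the group maps elliptic points to elliptic points, hence fixes w or moves it
   by at least delta. If rho(z,w) < kappa then delta <= 1/40, and:
   - powers of a rotation about z show that its order is 2, 3, 4, 5 or 6, and
     passing to a power one may take it to be 2, 3 or 5 (or 4);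
   - if A, B are such rotations about z and w, not both of order 2, then AB is
     nearly a rotation of a Euclidean triangle group, and a suitable power of AB
     moves w by a nonzero amount less than delta, a contradiction;
   - if both have order 2, AB is hyperbolic of translation length 2 rho(z,w). *)

Import Order.TTheory GRing.Theory Num.Theory.
Import numFieldNormedType.Exports.

Local Open Scope classical_set_scope.
Local Open Scope ring_scope.

(** * Derivative rules and a calibration bound for the length of a path *)

Section calculus.
Set Implicit Arguments.
Unset Strict Implicit.
Variable R : realType.
Implicit Types f g x y : R -> R.

Lemma is_derive_cstf (c t : R) : is_derive t 1 (fun _ : R => c) 0.
Proof. exact: is_derive_cst. Qed.

Lemma is_derive_addf f g (t df dg : R) : is_derive t 1 f df ->
  is_derive t 1 g dg -> is_derive t 1 (fun s => f s + g s) (df + dg).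
Proof. by move=> ? ?; exact: is_deriveD. Qed.

Lemma is_derive_mulf f g (t df dg : R) : is_derive t 1 f df ->
  is_derive t 1 g dg -> is_derive t 1 (fun s => f s * g s) (f t * dg + g t * df).
Proof. by move=> ? ?; exact: is_deriveM. Qed.

Lemma is_derive_invf f (t df : R) : f t != 0 -> is_derive t 1 f df ->
  is_derive t 1 (fun s => (f s)^-1) (- (f t) ^- 2 * df).
Proof. by move=> ? ?; exact: is_deriveV. Qed.

Lemma is_derive_lnf f (t df : R) : 0 < f t -> is_derive t 1 f df ->
  is_derive t 1 (fun s => ln (f s)) (df / f t).
Proof.
move=> f0 fd; rewrite mulrC; exact: (is_derive1_comp (is_derive1_ln f0) fd).
Qed.

Lemma is_derive_expRf f (t df : R) : is_derive t 1 f df ->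
  is_derive t 1 (fun s => expR (f s)) (expR (f t) * df).
Proof. by move=> fd; exact: (is_derive1_comp (is_derive_expR (f t)) fd). Qed.

Lemma is_derive_continuous f (t df : R) : is_derive t 1 f df -> {for t, continuous f}.
Proof. by move=> [fd _]; apply/differentiable_continuous/derivable1_diffP. Qed.

Lemma continuous_mulf f g (t : R) : {for t, continuous f} -> {for t, continuous g} ->
  {for t, continuous (fun s => f s * g s)}.
Proof. by move=> fc gc; apply: cvgM; [exact: fc|exact: gc]. Qed.

Lemma C1_of_is_derive f (df : R -> R) :
  (forall t : R, is_derive t 1 f (df t)) -> continuous df -> C1 f /\ derive1 f = df.
Proof.
move=> fd cdf; have e : derive1 f = df.
  by apply/funext => t; rewrite derive1E derive_val.
by split=> //; split=> [t|]; rewrite ?e.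
Qed.

Lemma C1_is_derive f (t : R) : C1 f -> is_derive t 1 f (derive1 f t).
Proof. by move=> [fd _]; rewrite derive1E; exact/derivableP. Qed.

Let speed x y (t : R) := Num.sqrt (derive1 x t ^+ 2 + derive1 y t ^+ 2) / y t.

Lemma continuous_speed x y : C1 x -> C1 y ->
  (forall t : R, t \in `[0, 1] -> 0 < y t) ->
  {within `[0, 1], continuous (speed x y)}.
Proof.
move=> [xd cx] [yd cy] y0; apply: continuous_in_subspaceT => t.
rewrite inE /= => t01; rewrite /speed; apply: cvgM; last first.
  apply: cvgV; first by rewrite gt_eqF ?y0.
  by apply/differentiable_continuous/derivable1_diffP.
apply: (@cvg_comp _ _ _ _ Num.sqrt); last exact: sqrt_continuous.
have sq g : continuous g -> {for t, continuous (fun s => g s ^+ 2)}.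
  by move=> cg; apply: (@continuous_comp _ _ _ g (fun s => s ^+ 2));
    [exact: cg|exact: exprn_continuous].
by apply: cvgD; [exact: sq cx|exact: sq cy].
Qed.

(* [F] is a function of the position whose gradient has hyperbolic norm at most
   1; only its restriction to the path is recorded. *)
Lemma calibration_le_length x y (F f : R -> R) : C1 x -> C1 y ->
  (forall t : R, t \in `[0, 1] -> 0 < y t) ->
  (forall t : R, t \in `[0, 1] -> is_derive t 1 F (f t)) ->
  (forall t : R, t \in `[0, 1] -> {for t, continuous f}) ->
  (forall t : R, t \in `[0, 1] ->
    f t * y t <= Num.sqrt (derive1 x t ^+ 2 + derive1 y t ^+ 2)) ->
  F 1 - F 0 <= hyp_length x y.
Proof.
move=> Cx Cy y0 Fd fc fle.
have fwc : {within `[0, 1], continuous f}.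
  by apply: continuous_in_subspaceT => t; rewrite inE; exact: fc.
have FC (t : R) : t \in `[0, 1]%R -> {for t, continuous F}.
  by move=> /Fd; exact: is_derive_continuous.
have <- : \int[lebesgue_measure]_(t in `[0%R, 1%R]) f t = F 1 - F 0.
  rewrite /Rintegral (@continuous_FTC2 _ f F) //.
  - split=> [t|| ].
    + by move=> /subset_itv_oo_cc /Fd [].
    + by apply: cvg_at_right_filter; apply: FC; rewrite in_itv /= lexx ler01.
    + by apply: cvg_at_left_filter; apply: FC; rewrite in_itv /= lexx ler01.
  - by move=> t /subset_itv_oo_cc /Fd h; rewrite derive1E derive_val.
apply: le_Rintegral => //.
- by apply: continuous_compact_integrable => //; exact: segment_compact.
- apply: continuous_compact_integrable; first exact: segment_compact.
  exact: continuous_speed.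
- by move=> t t01; rewrite ler_pdivlMr ?y0 // fle.
Qed.

End calculus.

(** * Calibrations adapted to vertical and circular geodesics *)

Section hyperbolic_distance.
Set Implicit Arguments.
Unset Strict Implicit.
Variable R : realType.
Implicit Types (x y F : R -> R) (z w : UHP R).

(** Calibrating by both [F] and [- F] controls the two signs of the increment; the gradient
    condition is squared so that it is the same for both. *)
Lemma calibration_norm x y F (f : R -> R) : C1 x -> C1 y ->
  (forall t : R, t \in `[0, 1] -> 0 < y t) ->
  (forall t : R, t \in `[0, 1] -> is_derive t 1 F (f t)) ->
  (forall t : R, t \in `[0, 1] -> {for t, continuous f}) ->
  (forall t : R, t \in `[0, 1] -> (f t * y t) ^+ 2 <= derive1 x t ^+ 2 + derive1 y t ^+ 2) ->
  `|F 1 - F 0| <= hyp_length x y.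
Proof.
move=> Cx Cy y0 Fd fc fle.
have le_sqrt (a b : R) : a ^+ 2 <= b -> a <= Num.sqrt b.
  by move=> /ler_wsqrtr; apply: le_trans; rewrite sqrtr_sqr ler_norm.
rewrite ler_norml lerNl; apply/andP; split; last first.
  by apply: (calibration_le_length Cx Cy y0 Fd fc) => t t01; exact/le_sqrt/fle.
have -> : - (F 1 - F 0) = (- F 1) - (- F 0) by ring.
apply: (@calibration_le_length _ x y (fun t => - F t) (fun t => - f t)) => //.
- by move=> t t01; apply: is_deriveN; exact: Fd.
- by move=> t t01; apply: cvgN; exact: fc.
- by move=> t t01; apply/le_sqrt; rewrite mulNr sqrrN; exact: fle.
Qed.

(** The logarithm of the height has hyperbolic gradient of norm 1, so the only loss is the
    horizontal part of the speed. *)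
Lemma vertical_calibration x y : C1 x -> C1 y ->
  (forall t : R, t \in `[0, 1] -> 0 < y t) ->
  `|ln (y 1) - ln (y 0)| <= hyp_length x y.
Proof.
move=> Cx Cy y0.
apply: (@calibration_norm x y (fun t => ln (y t)) (fun t => derive1 y t / y t)) => // t t01.
- by apply: is_derive_lnf; [exact: y0|exact: C1_is_derive].
- apply: cvgM; first exact: Cy.2.
  apply: cvgV; first by rewrite gt_eqF ?y0.
  exact: is_derive_continuous (C1_is_derive t Cy).
- by rewrite divfK ?gt_eqF ?y0 // lerDr sqr_ge0.
Qed.

(* Calibration by the logarithm of |zeta - a| / |zeta - b|, where a and b are
   the endpoints at infinity of the geodesic. *)
Lemma circle_calibration (a b : R) x y F : C1 x -> C1 y ->
  (forall t : R, t \in `[0, 1] -> 0 < y t) ->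
  (forall t, F t =
    (ln ((x t - a) ^+ 2 + y t ^+ 2) - ln ((x t - b) ^+ 2 + y t ^+ 2)) / 2) ->
  `|F 1 - F 0| <= hyp_length x y.
Proof.
move=> Cx Cy y0 FE.
(* [N u] is the squared Euclidean distance to the boundary point [u], and [dN u] is half its
   derivative along the path. *)
pose N u t := (x t - u) * (x t - u) + y t * y t.
pose dN u t := (x t - u) * derive1 x t + y t * derive1 y t.
have N0 u (t : R) : t \in `[0, 1] -> 0 < N u t.
  by move=> t01; rewrite ltr_wpDl ?mulr_gt0 ?y0 // -expr2 sqr_ge0.
have xcs t := is_derive_continuous (C1_is_derive t Cx).
have ycs t := is_derive_continuous (C1_is_derive t Cy).
have xucs u (t : R) : {for t, continuous (fun s => x s - u)}.
  by apply: cvgB; [exact: xcs|exact: cvg_cst].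
have Nd u (t : R) : is_derive t 1 (N u) (2 * dN u t).
  have xu : is_derive t 1 (fun s => x s - u) (derive1 x t).
    have := is_derive_addf (C1_is_derive t Cx) (is_derive_cstf (- u) t).
    by rewrite addr0.
  have := is_derive_addf (is_derive_mulf xu xu)
    (is_derive_mulf (C1_is_derive t Cy) (C1_is_derive t Cy)).
  by move=> /is_derive_eq; apply; rewrite /dN; ring.
have dNc u (t : R) : {for t, continuous (dN u)}.
  apply: cvgD; apply: cvgM; [exact: xucs|exact: Cx.2|exact: ycs|exact: Cy.2].
pose F' t := (ln (N a t) + (- 1) * ln (N b t)) * 2^-1.
have -> : F = F'.
  by apply/funext => t; rewrite FE /F' /N !expr2; ring.
apply: (@calibration_norm x y F' (fun t => dN a t / N a t - dN b t / N b t)) => // t t01.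
- have la := is_derive_lnf (N0 a t t01) (Nd a t).
  have lb := is_derive_lnf (N0 b t t01) (Nd b t).
  have := is_derive_mulf (is_derive_addf la
    (is_derive_mulf (is_derive_cstf (- 1) t) lb)) (is_derive_cstf 2^-1 t).
  move=> /is_derive_eq; apply; rewrite !(mulr0, addr0, add0r) /=; field.
  by rewrite !gt_eqF ?N0.
- have Nc u : {for t, continuous (N u)} by exact: is_derive_continuous (Nd u t).
  by apply: cvgB; apply: cvgM; try exact: dNc; apply: cvgV; try exact: Nc;
    rewrite gt_eqF ?N0.
- have Na := N0 a t t01; have Nb := N0 b t t01; have yt := y0 t t01.
  have PQ : 0 < N a t * N b t by exact: mulr_gt0.
  rewrite -(ler_pM2r (exprn_gt0 2 PQ)) -exprMn.
  have -> : (dN a t / N a t - dN b t / N b t) * y t * (N a t * N b t)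
      = (dN a t * N b t - dN b t * N a t) * y t.
    by field; rewrite !gt_eqF.
  rewrite /dN; move: (derive1 x t) (derive1 y t) => x' y'.
  (* [X] and [Y] are the partial derivatives of the calibration, multiplied by [N a t * N b t]. *)
  pose X := (x t - a) * N b t - (x t - b) * N a t.
  pose Y := y t * (N b t - N a t).
  have -> : ((x t - a) * x' + y t * y') * N b t - ((x t - b) * x' + y t * y') * N a t
     = X * x' + Y * y' by rewrite /X /Y; ring.
  (* Cauchy-Schwarz, through Lagrange's identity. *)
  apply: (@le_trans _ _ ((X ^+ 2 + Y ^+ 2) * y t ^+ 2 * (x' ^+ 2 + y' ^+ 2))).
    rewrite exprMn -subr_ge0.
    have -> : (X ^+ 2 + Y ^+ 2) * y t ^+ 2 * (x' ^+ 2 + y' ^+ 2) -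
      (X * x' + Y * y') ^+ 2 * y t ^+ 2 = ((X * y' - Y * x') * y t) ^+ 2 by ring.
    exact: sqr_ge0.
  rewrite mulrC; apply: ler_wpM2l; first by rewrite addr_ge0 ?sqr_ge0.
  have -> : X ^+ 2 + Y ^+ 2 = N a t * N b t * (a - b) ^+ 2.
    by rewrite /X /Y /N; ring.
  rewrite -mulrA expr2; apply: ler_wpM2l; first exact: ltW.
  rewrite -subr_ge0.
  (* The defect is a square that vanishes exactly on the semicircle with endpoints [a] and [b],
     where the calibration is sharp. *)
  have -> : N a t * N b t - (a - b) ^+ 2 * y t ^+ 2 =
     ((x t - a) * (x t - b) + y t ^+ 2) ^+ 2 by rewrite /N; ring.
  exact: sqr_ge0.
Qed.

End hyperbolic_distance.

(** * Explicit geodesics and their lengths *)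

Section distance_formula.
Set Implicit Arguments.
Unset Strict Implicit.
Variable R : realType.
Implicit Types (x y : R -> R) (z w : UHP R).

Lemma hyp_length_cst_speed x y (k : R) :
  (forall t, 0 < y t) ->
  (forall t, derive1 x t ^+ 2 + derive1 y t ^+ 2 = (k * y t) ^+ 2) ->
  hyp_length x y = `|k|.
Proof.
move=> y0 s; rewrite /hyp_length.
under eq_Rintegral => t _.
  rewrite s sqrtr_sqr normrM (gtr0_norm (y0 t)) mulfK ?gt_eqF ?y0 //.
  over.
rewrite Rintegral_cst //= lebesgue_measure_itv /= lte_fin ltr01 /=.
by rewrite oppr0 addr0 mulr1.
Qed.

(** Geometric interpolation makes [ln h] affine in [t], which gives constant hyperbolic speed on
    both kinds of geodesics. *)
Lemma exponential_arc (h0 h1 : R) : 0 < h0 -> 0 < h1 ->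
  exists h : R -> R, [/\ forall t : R, is_derive t 1 h (h t * (ln h1 - ln h0)),
    forall t, 0 < h t, h 0 = h0 & h 1 = h1].
Proof.
move=> h0p h1p; pose k := ln h1 - ln h0.
pose h t := expR (ln h0 + k * t); exists h; split.
- move=> t; have := is_derive_expRf (is_derive_addf (is_derive_cstf (ln h0) t)
    (is_derive_mulf (is_derive_cstf k t) (is_derive_id t 1))).
  by move=> /is_derive_eq; apply; rewrite /h -/k; ring.
- by move=> t; exact: expR_gt0.
- by rewrite /h mulr0 addr0 lnK ?posrE.
- by rewrite /h mulr1 /k addrC subrK lnK ?posrE.
Qed.

Lemma vertical_geodesic (c h0 h1 : R) : 0 < h0 -> 0 < h1 ->
  exists x y, [/\ C1 x, C1 y, forall t, 0 < y t &
    [/\ x 0 = c, y 0 = h0, x 1 = c, y 1 = h1 & hyp_length x y = `|ln h1 - ln h0|]].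
Proof.
move=> h0p h1p; have [h [hd hp h0E h1E]] := exponential_arc h0p h1p.
set k := ln h1 - ln h0 in hd *.
have hc (t : R) : {for t, continuous h} by exact: is_derive_continuous (hd t).
have [Ch dh] : C1 h /\ derive1 h = (fun t => h t * k).
  by apply: C1_of_is_derive hd _ => t; apply: cvgM; [exact: hc|exact: cvg_cst].
have [Cc dc] : C1 (fun _ : R => c) /\ derive1 (fun _ : R => c) = (fun=> 0).
  by apply: C1_of_is_derive => t; exact: cvg_cst.
exists (fun=> c), h; split => //; split => //.
apply: hyp_length_cst_speed => t; first exact: hp.
by rewrite dc dh; ring.
Qed.

(* Points of the geodesic of center c and radius r; the coordinate ln h is
   arc length. *)
Definition circle_x (c r h : R) := c + r * (1 - 2 / (h ^+ 2 + 1)).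
Definition circle_y (r h : R) := 2 * r * h / (h ^+ 2 + 1).

Lemma circle_geodesic (c r h0 h1 : R) : 0 < r -> 0 < h0 -> 0 < h1 ->
  exists x y, [/\ C1 x, C1 y, forall t, 0 < y t &
    [/\ x 0 = circle_x c r h0, y 0 = circle_y r h0,
        x 1 = circle_x c r h1, y 1 = circle_y r h1
      & hyp_length x y = `|ln h1 - ln h0|]].
Proof.
move=> r0 h0p h1p; have [h [hd hp h0E h1E]] := exponential_arc h0p h1p.
set k := ln h1 - ln h0 in hd *.
have hc (t : R) : {for t, continuous h} by exact: is_derive_continuous (hd t).
pose m t := h t * h t + 1.
have m0 t : 0 < m t by rewrite ltr_wpDl // -expr2 sqr_ge0.
have md (t : R) : is_derive t 1 m (2 * k * h t ^+ 2).
  have := is_derive_addf (is_derive_mulf (hd t) (hd t)) (is_derive_cstf 1 t).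
  by move=> /is_derive_eq; apply; ring.
have vd (t : R) := is_derive_invf (lt0r_neq0 (m0 t)) (md t).
have vc (t : R) : {for t, continuous (fun t => (m t)^-1)}.
  by exact: is_derive_continuous (vd t).
have h2c (t : R) : {for t, continuous (fun t => h t * h t)}.
  by apply: cvgM; exact: hc.
have Mc := @continuous_mulf R.
pose x t := c + r * (1 + -2 * (m t)^-1); pose y t := 2 * r * (h t * (m t)^-1).
have [Cx dx] : C1 x /\ derive1 x =
    (fun t => 4 * r * k * (h t * h t * ((m t)^-1 * (m t)^-1))).
  apply: C1_of_is_derive => t.
    have := is_derive_addf (is_derive_cstf c t) (is_derive_mulf (is_derive_cstf r t)
      (is_derive_addf (is_derive_cstf 1 t)
         (is_derive_mulf (is_derive_cstf (-2) t) (vd t)))).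
    by move=> /is_derive_eq; apply; field; rewrite gt_eqF.
  apply: (Mc _ _ t); first exact: cvg_cst.
  by apply: (Mc _ _ t); [exact: h2c|apply: (Mc _ _ t); exact: vc].
have [Cy dy] : C1 y /\ derive1 y =
    (fun t => 2 * r * k * (h t * ((1 + - (h t * h t)) * ((m t)^-1 * (m t)^-1)))).
  apply: C1_of_is_derive => t.
    have := is_derive_mulf (is_derive_cstf (2 * r) t) (is_derive_mulf (hd t) (vd t)).
    move=> /is_derive_eq; apply; rewrite /m; field.
    by have := m0 t; rewrite /m => ?; rewrite gt_eqF.
  apply: (Mc _ _ t); first exact: cvg_cst.
  apply: (Mc _ _ t); first exact: hc.
  apply: (Mc _ _ t); last by apply: (Mc _ _ t); exact: vc.
  by apply: cvgB; [exact: cvg_cst|exact: h2c].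
exists x, y; split => //.
  by move=> t; rewrite /y !mulr_gt0 // invr_gt0.
split; try by rewrite /x /y /m ?h0E ?h1E /circle_x /circle_y -?expr2; ring.
(* The speed is [k] times the height because [4 h^2 + (1 - h^2)^2 = (1 + h^2)^2]. *)
apply: hyp_length_cst_speed => t; first by rewrite /y !mulr_gt0 // invr_gt0.
rewrite dx dy /y /m; field.
by have := m0 t; rewrite /m => ?; rewrite gt_eqF.
Qed.

Lemma circle_through (x1 y1 x2 y2 : R) : x1 != x2 -> 0 < y1 -> 0 < y2 ->
  exists c r h1 h2, [/\ 0 < r, 0 < h1, 0 < h2 &
    [/\ circle_x c r h1 = x1, circle_y r h1 = y1,
        circle_x c r h2 = x2 & circle_y r h2 = y2]].
Proof.
move=> x12 y1p y2p.
(* The perpendicular bisector of the two points meets the real axis at [c]. *)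
pose c := ((x2 ^+ 2 + y2 ^+ 2) - (x1 ^+ 2 + y1 ^+ 2)) / (2 * (x2 - x1)).
pose r := Num.sqrt ((x1 - c) ^+ 2 + y1 ^+ 2).
have s1 : 0 < (x1 - c) ^+ 2 + y1 ^+ 2 by rewrite ltr_wpDl ?sqr_ge0 // exprn_gt0.
have r0 : 0 < r by rewrite sqrtr_gt0.
have r1 : r ^+ 2 = (x1 - c) ^+ 2 + y1 ^+ 2 by rewrite sqr_sqrtr // ltW.
have r2 : r ^+ 2 = (x2 - c) ^+ 2 + y2 ^+ 2.
  by rewrite r1 /c; field; rewrite subr_eq0 eq_sym.
have point u v : 0 < v -> r ^+ 2 = (u - c) ^+ 2 + v ^+ 2 ->
  exists h, [/\ 0 < h, circle_x c r h = u & circle_y r h = v].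
  move=> v0 ruv.
  have ru : 0 < r - (u - c).
    rewrite subr_gt0; apply: (le_lt_trans (ler_norm _)).
    by rewrite -sqrtr_sqr -(gtr0_norm r0) -(sqrtr_sqr r) ltr_sqrt ?exprn_gt0 //
      ruv ltrDl exprn_gt0.
  have m : (v / (r - (u - c))) ^+ 2 + 1 = 2 * r / (r - (u - c)).
    have v2 : v ^+ 2 = (r - (u - c)) * (r + (u - c)).
      by rewrite -subr_sqr ruv addrC addKr.
    by rewrite expr_div_n v2; field; rewrite gt_eqF.
  (* By Thales the point sees the diameter under a right angle, so this tangent of the angle at
     [c + r] is the ratio of the distances to [c - r] and [c + r]. *)
  exists (v / (r - (u - c))); split; first exact: divr_gt0.
    by rewrite /circle_x m; field; rewrite !gt_eqF.
  by rewrite /circle_y m; field; rewrite !gt_eqF.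
have [h1 [h1p <- <-]] := point x1 y1 y1p r1.
have [h2 [h2p <- <-]] := point x2 y2 y2p r2.
by exists c, r, h1, h2.
Qed.

(** Identifies the arc length parameter with the value of the circular calibration, so the upper and
    lower bounds for the distance coincide. *)
Lemma ln_circle (c r h : R) : 0 < r -> 0 < h ->
  ln h = (ln ((circle_x c r h - (c - r)) ^+ 2 + circle_y r h ^+ 2)
     - ln ((circle_x c r h - (c + r)) ^+ 2 + circle_y r h ^+ 2)) / 2.
Proof.
move=> r0 h0; have m0 : 0 < h ^+ 2 + 1 by rewrite ltr_wpDl ?sqr_ge0.
have -> : (circle_x c r h - (c - r)) ^+ 2 + circle_y r h ^+ 2 =
   4 * r ^+ 2 / (h ^+ 2 + 1) * h ^+ 2.
  by rewrite /circle_x /circle_y; field; rewrite gt_eqF.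
have -> : (circle_x c r h - (c + r)) ^+ 2 + circle_y r h ^+ 2 = 4 * r ^+ 2 / (h ^+ 2 + 1).
  by rewrite /circle_x /circle_y; field; rewrite gt_eqF.
have K0 : 0 < 4 * r ^+ 2 / (h ^+ 2 + 1) by rewrite divr_gt0 // mulr_gt0 ?exprn_gt0.
rewrite lnM ?posrE ?exprn_gt0 // lnXn // mulr2n.
by field.
Qed.

End distance_formula.

(** * Closed form of the distance *)

Section distance_formula.
Set Implicit Arguments.
Unset Strict Implicit.
Variable R : realType.
Implicit Types (x y : R -> R) (z w : UHP R).

Lemma rho_unique z w (d : R) :
  (exists x y, C1_path x y z w /\ hyp_length x y = d) ->
  (forall x y, C1_path x y z w -> d <= hyp_length x y) -> rho z w = d.
Proof.
move=> [x [y [xy <-]]] h; apply/eqP; rewrite eq_le; apply/andP; split.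
  apply: ge_inf; last by exists x, y.
  by exists (hyp_length x y) => _ [x' [y' [xy' ->]]]; exact: h.
apply: lb_le_inf; first by exists (hyp_length x y), x, y.
by move=> _ [x' [y' [xy' ->]]]; exact: h.
Qed.

Definition delta z w : R :=
  ((complex.Re z - complex.Re w) ^+ 2 + (complex.Im z - complex.Im w) ^+ 2)
  / (complex.Im z * complex.Im w).

Lemma delta_ge0 z w : 0 <= delta z w.
Proof.
by rewrite divr_ge0 ?addr_ge0 ?sqr_ge0 // mulr_ge0 // ltW // UHP_pos.
Qed.

Lemma delta_sym z w : delta z w = delta w z.
Proof. by rewrite /delta; congr (_ / _); ring. Qed.

Lemma delta_eq0 z w : delta z w = 0 -> z = w.
Proof.
have yy : complex.Im z * complex.Im w != 0 by rewrite mulf_neq0 ?gt_eqF ?UHP_pos.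
move=> /eqP; rewrite mulf_eq0 invr_eq0 (negPf yy) orbF.
rewrite paddr_eq0 ?sqr_ge0 // !sqrf_eq0 !subr_eq0 => /andP[/eqP e1 /eqP e2].
by apply: val_inj; move: z w yy e1 e2 => [[? ?] ?] [[? ?] ?] /= _ -> ->.
Qed.

Lemma expR_normlnB (h0 h1 : R) : 0 < h0 -> 0 < h1 ->
  expR `|ln h1 - ln h0| + expR (- `|ln h1 - ln h0|) - 2 = (h0 - h1) ^+ 2 / (h0 * h1).
Proof.
move=> h0p h1p.
have -> : expR `|ln h1 - ln h0| + expR (- `|ln h1 - ln h0|) =
   expR (ln h1 - ln h0) + expR (ln h0 - ln h1).
  case: (ler0P (ln h1 - ln h0)) => _; last by rewrite opprB.
  by rewrite opprK opprB addrC.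
rewrite !expRD !expRN !lnK ?posrE //; field.
by rewrite !gt_eqF.
Qed.

(* This says cosh (rho z w) = 1 + delta z w / 2. *)
Theorem rho_delta z w :
  0 <= rho z w /\ expR (rho z w) + expR (- rho z w) - 2 = delta z w.
Proof.
(* The parameter [h] is the height when the points lie on a vertical line, and the parameter of
   [circle_x] and [circle_y] otherwise. *)
suff [h0 [h1 [h0p h1p r <-]]] : exists h0 h1, [/\ 0 < h0, 0 < h1,
    rho z w = `|ln h1 - ln h0| & (h0 - h1) ^+ 2 / (h0 * h1) = delta z w].
  by rewrite r normr_ge0 expR_normlnB.
move: z w => [[x1 y1] /= y1p] [[x2 y2] /= y2p].
have [->|x12] := eqVneq x1 x2.
  exists y1, y2; split => //; last first.
    by rewrite /delta /=; congr (_ / _); ring.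
  apply: rho_unique => [|x y [Cx Cy y0 [/= e1 e2] [/= e3 e4]]]; last first.
    by rewrite -e2 -e4; exact: vertical_calibration.
  have [x [y [Cx Cy y0 [e1 e2 e3 e4 <-]]]] := vertical_geodesic x2 y1p y2p.
  exists x, y; split => //; split => //=.
    by rewrite e1 e2.
  by rewrite e3 e4.
have [c [r [h0 [h1 [r0 h0p h1p [e1 e2 e3 e4]]]]]] := circle_through x12 y1p y2p.
exists h0, h1; split => //; last first.
  rewrite /delta /= -e1 -e2 -e3 -e4 /circle_x /circle_y.
  by field; rewrite !gt_eqF //= ltr_wpDl ?sqr_ge0.
apply: rho_unique => [|x y [Cx Cy y0 [/= f1 f2] [/= f3 f4]]].
  have [x [y [Cx Cy y0 [f1 f2 f3 f4 <-]]]] := circle_geodesic c r0 h0p h1p.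
  exists x, y; split => //; split => //=.
    by rewrite f1 f2 e1 e2.
  by rewrite f3 f4 e3 e4.
rewrite (ln_circle c r0 h0p) (ln_circle c r0 h1p) e1 e2 e3 e4 -f1 -f2 -f3 -f4.
pose F t := (ln ((x t - (c - r)) ^+ 2 + y t ^+ 2) - ln ((x t - (c + r)) ^+ 2 + y t ^+ 2)) / 2.
exact: (@circle_calibration _ (c - r) (c + r) x y F).
Qed.

(** [2 cosh - 2] increases on nonnegative reals; hence a pair minimizing [rho] also minimizes the
    algebraic quantity [delta]. *)
Lemma rho_monotone z w z' w' : rho z w <= rho z' w' -> delta z w <= delta z' w'.
Proof.
have [r0 <-] := rho_delta z w; have [r0' <-] := rho_delta z' w'.
move: (rho z w) (rho z' w') r0 r0' => a b a0 b0 ab.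
rewrite lerD2r !expRN -subr_ge0.
have ea := expR_gt0 a; have eb := expR_gt0 b.
have a1 : 1 <= expR a by rewrite -(expR0 R) ler_expR.
have eab : expR a <= expR b by rewrite ler_expR.
have -> : expR b + (expR b)^-1 - (expR a + (expR a)^-1) =
   (expR b - expR a) * (expR a * expR b - 1) / (expR a * expR b).
  by field; rewrite !gt_eqF.
rewrite divr_ge0 ?mulr_ge0 ?subr_ge0 // ?(ltW ea) ?(ltW eb) //.
by rewrite -[1]mulr1 ler_pM // (le_trans a1).
Qed.

(** Both sides are [(delta z w + 2) ^+ 2 - 4], since [delta z w + 2] is twice the hyperbolic cosine
    of the distance. *)
Lemma delta_sinh z w : delta z w * (delta z w + 4) = 4 * sinh (rho z w) ^+ 2.
Proof.
have [r0 <-] := rho_delta z w; rewrite /sinh expRN.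
by field; rewrite gt_eqF ?expR_gt0.
Qed.

End distance_formula.

(** * Numerical enclosures of C and kappa *)

Section constants.
Set Implicit Arguments.
Unset Strict Implicit.
Variable R : realType.

(** At [t = pi / 7] the relation [cos 4t = - cos 3t] is a quartic in [cos t]; removing its root -1
    leaves the cubic. The bound, which comes from [cos 2t > 0], selects the largest root. *)
Lemma cos_pi7 : 8 * cos (pi / 7 : R) ^+ 3 - 4 * cos (pi / 7) ^+ 2
  - 4 * cos (pi / 7) + 1 = 0 /\ 7 / 10 < cos (pi / 7 : R).
Proof.
set t : R := pi / 7; set c := cos t.
have pi0 := pi_gt0 R.
have c0 : 0 < c by apply: cos_gt0_pihalf; rewrite /t; apply/andP; split; lra.
have c2E : cos (t *+ 2) = c ^+ 2 *+ 2 - 1 by rewrite cos_mulr2n.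
have c2 : 0 < cos (t *+ 2) by apply: cos_gt0_pihalf; rewrite /t; apply/andP; split; lra.
have c3E : cos (t *+ 3) = 4 * c ^+ 3 - 3 * c.
  rewrite mulrSr cosD c2E sin_mulr2n -/c.
  have -> : (c * sin t) *+ 2 * sin t = (c *+ 2) * (sin t ^+ 2) by ring.
  have := cos2Dsin2 t; rewrite -/c => /(canRL (addKr _)) ->; ring.
have c4E : cos (t *+ 4) = (c ^+ 2 *+ 2 - 1) ^+ 2 *+ 2 - 1.
  by rewrite (_ : t *+ 4 = t *+ 2 *+ 2) ?cos_mulr2n // -mulrnA.
have c34 : cos (t *+ 4) = - cos (t *+ 3).
  rewrite (_ : t *+ 4 = - (t *+ 3) + pi) ?cosDpi ?cosN //.
  by rewrite /t; field.
split; last first.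
  rewrite ltNge; apply/negP => cle.
  have : c ^+ 2 <= (7 / 10) ^+ 2 by rewrite lerXn2r // nnegrE; lra.
  by move: c2; rewrite c2E; lra.
have : (c + 1) * (8 * c ^+ 3 - 4 * c ^+ 2 - 4 * c + 1) = 0.
  have -> : (c + 1) * (8 * c ^+ 3 - 4 * c ^+ 2 - 4 * c + 1) =
    ((c ^+ 2 *+ 2 - 1) ^+ 2 *+ 2 - 1) + (4 * c ^+ 3 - 3 * c) by ring.
  by rewrite -c4E -c3E c34 addNr.
by move/eqP; rewrite mulf_eq0 gt_eqF ?addr_gt0 //= => /eqP.
Qed.

Lemma le_sqrt (a b : R) : 0 <= a -> a ^+ 2 <= b -> a <= Num.sqrt b.
Proof. by move=> a0 /ler_wsqrtr; rewrite sqrtr_sqr ger0_norm. Qed.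

Lemma sqrt_lt (a b : R) : 0 < a -> b < a ^+ 2 -> Num.sqrt b < a.
Proof.
move=> a0 ba; rewrite -[ltRHS](gtr0_norm a0) -sqrtr_sqr ltr_sqrt //.
by rewrite exprn_gt0.
Qed.

Lemma Cconst_bounds : (131 + 8 / 10) / 1000 <= Cconst R < (131 + 9 / 10) / 1000.
Proof.
have [] := cos_pi7; rewrite /Cconst; set c := cos _ => cE c7.
(* The cubic is negative from 7/10 up to its largest root and positive beyond it, which encloses
   that root. *)
have c_lo : (900 + 95 / 100) / 1000 < c.
  rewrite ltNge; apply/negP => h.
  have : 0 <= ((900 + 95 / 100) / 1000 - c) * (c - 7/10) by rewrite mulr_ge0; lra.
  nra.
have c_hi : c < (900 + 99 / 100) / 1000.
  rewrite ltNge; apply/negP => h.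
  nra.
have d0 : 0 < 8 * c + 7 by lra.
have q1 : ((131 + 8 / 10) / 1000) ^+ 2 <= (4 * c ^+ 2 - 3) / (8 * c + 7).
  by rewrite ler_pdivlMr //; nra.
have q2 : (4 * c ^+ 2 - 3) / (8 * c + 7) < ((131 + 9 / 10) / 1000) ^+ 2.
  by rewrite ltr_pdivrMr //; nra.
apply/andP; split; first by apply: le_sqrt q1; lra.
by apply: sqrt_lt q2; lra.
Qed.

Let frac (v : nat * nat) : R := v.1%:R / v.2%:R.

(* The bound [1 + x <= expR x], amplified by seven squarings with rounding. *)
Lemma le_expR_128 (x : R) (a : nat * nat) (b : seq (nat * nat)) :
  frac a <= 1 + x / 128 -> size b = 7 ->
  path (fun u v => frac v <= frac u * frac u) a b -> frac (last a b) <= expR x.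
Proof.
have f0 v : 0 <= frac v by rewrite divr_ge0 ?ler0n.
move=> ax sb pb.
have {ax} : frac a <= expR (x / 2 ^+ size b).
  by rewrite sb (le_trans ax) // (le_trans _ (expR_ge1Dx _)) // lerD2l; lra.
elim: b a pb {sb} => [|v b IH] a /=; first by rewrite expr0 divr1.
move=> /andP[va pb] ae; apply: IH => //.
have -> : x / 2 ^+ size b = x / 2 ^+ (size b).+1 + x / 2 ^+ (size b).+1.
  by rewrite exprS; field; rewrite expf_neq0.
by rewrite expRD (le_trans va) // ler_pM.
Qed.

Lemma kappa_bounds : 151 / 1000 <= kappa R < 152 / 1000.
Proof.
have /andP[C1 C2] := Cconst_bounds.
rewrite /kappa /arsinh; set y := 2 / Num.sqrt 3 * Cconst R.
have s3 : 0 < Num.sqrt (3 : R) by rewrite sqrtr_gt0.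
have y0 : 0 < y by rewrite /y mulr_gt0 ?divr_gt0 //; lra.
have y2 : y ^+ 2 = 4 / 3 * Cconst R ^+ 2.
  by rewrite /y exprMn expr_div_n sqr_sqrtr //; field.
have y_lo : (152 + 1 / 10) / 1000 < y by rewrite ltNge; apply/negP => h; nra.
have y_hi : y < (152 + 35 / 100) / 1000 by rewrite ltNge; apply/negP => h; nra.
set s := Num.sqrt _.
have sE : s ^+ 2 = y ^+ 2 + 1 by rewrite sqr_sqrtr // addr_ge0 ?sqr_ge0.
have s0 : 0 <= s by exact: sqrtr_ge0.
have ys0 : 0 < y + s by rewrite ltr_pwDl.
(* Each fraction in the list is a rounding down of the square of the preceding one, starting just
   below [1 + x / 128]. *)
have E2 : (1163 + 9 / 10) / 1000 <= expR (152 / 1000 : R).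
  apply: (le_trans _ (@le_expR_128 (152 / 1000) (4216, 4211)%N
    [:: (422, 421)%N; (1479, 1472)%N; (1059, 1049)%N; (1277, 1253)%N;
        (188, 181)%N; (821, 761)%N; (1193, 1025)%N] _ erefl _)) => /=;
    rewrite /frac /=; [lra|lra|].
  by rewrite andbT; repeat (apply/andP; split); lra.
(* The upper bound comes from a lower bound for the exponential at the opposite argument. *)
have E1 : expR (151 / 1000 : R) <= (1163 + 2 / 10) / 1000.
  have : 521 / 606 <= expR (- (151 / 1000) : R).
    apply: (le_trans _ (@le_expR_128 (- (151 / 1000)) (2540, 2543)%N
      [:: (423, 424)%N; (845, 849)%N; (843, 851)%N; (839, 855)%N;
          (883, 917)%N; (637, 687)%N; (521, 606)%N] _ erefl _)) => /=; rewrite /frac /=; [lra|lra|].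
    by rewrite andbT; repeat (apply/andP; split); lra.
  have := expR_gt0 (151 / 1000 : R); have := expRxMexpNx_1 (151 / 1000 : R).
  by nra.
apply/andP; split.
  rewrite -ler_expR lnK ?posrE // (le_trans E1) //.
  by rewrite leNgt; apply/negP => h; nra.
rewrite -ltr_expR lnK ?posrE // (lt_le_trans _ E2) //.
by rewrite ltNge; apply/negP => h; nra.
Qed.

End constants.

(** * Powers, displacements and rotations in SL(2,R) *)

Section matrices.
Set Implicit Arguments.
Unset Strict Implicit.
Variable R : realType.
Implicit Types (M N : SL2 R) (z w : UHP R).

Lemma matrix2P (A B : 'M[R]_2) : A 0 0 = B 0 0 -> A 0 1 = B 0 1 ->
  A 1 0 = B 1 0 -> A 1 1 = B 1 1 -> A = B.
Proof.
move=> h00 h01 h10 h11; apply/matrixP => i j.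
have two (k : 'I_2) : k = 0 \/ k = 1.
  by case: k => -[|[|//]] hk; [left|right]; exact: val_inj.
by case: (two i) => ->; case: (two j) => ->.
Qed.

Lemma mulmx2E (A B : 'M[R]_2) i j :
  (A *m B) i j = A i 0 * B 0 j + A i 1 * B 1 j.
Proof.
rewrite mxE !big_ord_recl big_ord0 addr0; congr (_ + A i _ * B _ j);
  exact: val_inj.
Qed.

Lemma mxtrace2 (A : 'M[R]_2) : \tr A = A 0 0 + A 1 1.
Proof.
rewrite /mxtrace !big_ord_recl big_ord0 addr0; congr (_ + A _ _);
  exact: val_inj.
Qed.

(* The matrix of determinant 1 and trace 0 acting as the half-turn about z. *)
Definition half_turn z : 'M[R]_2 :=
  let x := complex.Re z in let y := complex.Im z in
  \matrix_(i, j) (if i == 0 then if j == 0 then x / y else - (x ^+ 2 + y ^+ 2) / y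
                  else if j == 0 then y^-1 else - x / y).

(* Chebyshev polynomials of the second kind, shifted by one: sin (n a) / sin a
   for t = 2 cos a. *)
Fixpoint cheb (t : R) n : R :=
  match n with
  | 0%N => 0
  | 1%N => 1
  | (m.+1 as k).+1 => t * cheb t k - cheb t m
  end.

(** Cayley-Hamilton in determinant 1. *)
Lemma SL2_cayley M : SL2_mx M *m SL2_mx M = \tr M *: SL2_mx M - 1%:M.
Proof.
have := SL2_detE M; rewrite mxtrace2 => d.
apply: matrix2P; rewrite mulmx2E !mxE /= -?d; ring.
Qed.

(** Iterated Cayley-Hamilton. The exponent is shifted because exponent 0 would call for the
    Chebyshev value at index -1. *)
Lemma SL2_expg M n : SL2_mx (M ^+ n.+1)%g =
  cheb (\tr M) n.+1 *: SL2_mx M - cheb (\tr M) n *: 1%:M.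
Proof.
elim: n => [|n IH]; first by rewrite expg1 /= scale1r scale0r subr0.
rewrite expgSr (_ : SL2_mx (_ * _)%g = SL2_mx (M ^+ n.+1)%g *m SL2_mx M) // IH.
rewrite mulmxBl -!scalemxAl SL2_cayley mul1mx.
have -> : cheb (\tr M) n.+2 = \tr M * cheb (\tr M) n.+1 - cheb (\tr M) n by [].
by apply/matrixP => i j; rewrite !mxE; ring.
Qed.

(* The square of the displacement [2 sinh (rho w (A w) / 2)]. *)
Definition displ (A : 'M[R]_2) w : R :=
  let u := complex.Re w in let v := complex.Im w in
  ((A 1 0 * (u ^+ 2 - v ^+ 2) + (A 1 1 - A 0 0) * u - A 0 1) ^+ 2
   + (A 1 0 * (2 * u * v) + (A 1 1 - A 0 0) * v) ^+ 2) / v ^+ 2.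

Lemma Re_moebius M z :
  let x := complex.Re z in let y := complex.Im z in
  complex.Re (moebius M z) =
  (M 0 0 * M 1 0 * (x ^+ 2 + y ^+ 2) + (M 0 0 * M 1 1 + M 0 1 * M 1 0) * x + M 0 1 * M 1 1)
  / ((M 1 0 * x + M 1 1) ^+ 2 + (M 1 0 * y) ^+ 2).
Proof.
case: z => [[x y] /= y0].
rewrite /moebius /moebius_num /moebius_den /= !mul0r !subr0 !addr0.
by set d := (_ + _ : R)^-1; ring.
Qed.

Lemma moebius_den_gt0 M z :
  0 < (M 1 0 * complex.Re z + M 1 1) ^+ 2 + (M 1 0 * complex.Im z) ^+ 2.
Proof.
have := moebius_pos M z; rewrite Im_moebius pmulr_rgt0 ?UHP_pos // invr_gt0.
by case: z => [[x y] /= y0]; rewrite /moebius_den /= !mul0r !subr0 !addr0.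
Qed.

(** For entries [a, b, c, d], [w - M w] is [(c w^2 + (d - a) w - b) / (c w + d)] and the height of
    [M w] is that of [w] over [|c w + d|^2]; the denominators cancel. *)
Lemma delta_act M w : delta w (SL2_act M w) = displ M w.
Proof.
have n0 := moebius_den_gt0 M w; have iE := Im_moebius M w.
rewrite /delta [complex.Re (SL2_act M w)]Re_moebius [complex.Im (SL2_act M w)]iE /displ {iE}.
have d := SL2_detE M.
case: w n0 => [[u v] /= v0]; rewrite /moebius_den /= !mul0r !subr0 !addr0.
set n := _ + _ => n0.
(* Inserting the determinant turns the claim into an identity of rational functions. *)
have -> : v - v / n = v - v / n * (M 0 0 * M 1 1 - M 0 1 * M 1 0) by rewrite d mulr1.
rewrite /n in n0 *.
by field; rewrite !gt_eqF.
Qed.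

Lemma displ_lin (A : 'M[R]_2) (s r : R) w : displ (s *: A + r *: 1%:M) w = s ^+ 2 * displ A w.
Proof. by rewrite /displ !mxE /=; ring. Qed.

(** The half-turn carries [w] to its reflection through [z], at distance [2 * rho z w], and the
    right side is [4 sinh^2] of [rho z w]. *)
Lemma displ_half_turn z w : displ (half_turn z) w = delta z w * (delta z w + 4).
Proof.
case: z => [[x y] /= y0]; case: w => [[u v] /= v0]; rewrite /displ /delta !mxE /=.
by field; rewrite !gt_eqF.
Qed.

(** Zero displacement is a real quadratic equation satisfied by [z]; its real and imaginary parts
    express the right column of [M] through the left one. *)
Lemma fixed_decomposition M z : SL2_act M z = z ->
  exists p q, SL2_mx M = p *: 1%:M + q *: half_turn z /\ p ^+ 2 + q ^+ 2 = 1.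
Proof.
move=> Mz; have : displ M z = 0.
  by rewrite -delta_act Mz /delta !subrr expr0n addr0 mul0r.
have d := SL2_detE M.
case: z {Mz} => [[x y] /= y0]; rewrite /displ /= => /eqP.
rewrite mulf_eq0 invr_eq0 expf_eq0 (gt_eqF y0) andbF orbF.
rewrite paddr_eq0 ?sqr_ge0 // !expf_eq0 /= => /andP[/eqP e1].
have -> : M 1 0 * (2 * x * y) + (M 1 1 - M 0 0) * y =
  (M 1 0 * (2 * x) + (M 1 1 - M 0 0)) * y by ring.
rewrite mulf_eq0 (gt_eqF y0) orbF => /eqP e2.
exists (M 0 0 - M 1 0 * x), (M 1 0 * y).
have f11 : M 1 1 = M 0 0 - M 1 0 * (2 * x) by lra.
have f01 : M 0 1 = - M 1 0 * (x ^+ 2 + y ^+ 2) by move: e1; rewrite f11; lra.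
split; last by rewrite -[RHS]d f11 f01; ring.
apply: matrix2P; rewrite !mxE /=.
- by field; rewrite gt_eqF.
- by rewrite f01; field; rewrite gt_eqF.
- by field; rewrite gt_eqF.
- by rewrite f11; field; rewrite gt_eqF.
Qed.

Lemma act_half_turn_comb M z (p q : R) : SL2_mx M = p *: 1%:M + q *: half_turn z ->
  SL2_act M z = z.
Proof.
move=> ME; apply/esym/delta_eq0; rewrite delta_act ME addrC displ_lin displ_half_turn.
by rewrite /delta !subrr expr0n addr0 !mul0r mulr0.
Qed.

(** Half-turns are traceless and a product of two has trace [- 2 cosh] of the distance between their
    centers, that is [- (delta z w + 2)]. *)
Lemma tr_half_turns z w (p q p' q' : R) :
  \tr ((p *: 1%:M + q *: half_turn z) *m (p' *: 1%:M + q' *: half_turn w)) =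
  2 * p * p' - q * q' * (delta z w + 2).
Proof.
case: z => [[x y] /= y0]; case: w => [[u v] /= v0]; rewrite mxtrace2 !mulmx2E /delta !mxE /=.
by field; rewrite !gt_eqF.
Qed.

End matrices.

(** * The gap that minimality imposes on group elements *)

Section gap.
Set Implicit Arguments.
Unset Strict Implicit.
Variable R : realType.
Implicit Types (M N : SL2 R) (z w : UHP R) (G : set (PSL2 R)) (g h : PSL2 R).

Lemma SL2_actM M N z : SL2_act (M * N)%g z = SL2_act M (SL2_act N z).
Proof.
apply: val_inj; rewrite /= /moebius.
have n0 := moebius_den_neq0 N z.
have -> : moebius_den (M * N)%g z =
    (M 1 0)%:C%C * moebius_num N z + (M 1 1)%:C%C * moebius_den N z.
  by rewrite /moebius_den /moebius_num /= !mulmx2E !rmorphD !rmorphM /=; ring.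
have -> : moebius_num (M * N)%g z =
    (M 0 0)%:C%C * moebius_num N z + (M 0 1)%:C%C * moebius_den N z.
  by rewrite /moebius_den /moebius_num /= !mulmx2E !rmorphD !rmorphM /=; ring.
have m0 : (M 1 0)%:C%C * moebius_num N z + (M 1 1)%:C%C * moebius_den N z != 0.
  have := moebius_den_neq0 M (SL2_act N z); rewrite {1}/moebius_den /= /moebius.
  apply: contraNN => /eqP e; rewrite mulrA -[X in _ + X](mulfK n0) -mulrDl e.
  by rewrite mul0r.
rewrite /moebius; move: n0 m0; set n := moebius_num N z; set d := moebius_den N z.
move=> n0 m0; rewrite /moebius_num /moebius_den.
by field; rewrite n0 m0.
Qed.

Lemma PSL2_actM g h z : PSL2_act (g * h)%g z = PSL2_act g (PSL2_act h z).
Proof.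
move: g h; apply: toPSL2_ind => M; apply: toPSL2_ind => N.
by rewrite [(_ * _)%g]toPSL2M !PSL2_actE SL2_actM.
Qed.

Lemma elliptic_points_orbit G g z : is_subgroup G -> G g ->
  elliptic_points G z -> elliptic_points G (PSL2_act g z).
Proof.
move=> [G1 GM GV] Gg [h [Gh [h1 [z' hz']] hz]]; exists (g * h * g^-1)%g.
have fix_gz : PSL2_act (g * h * g^-1)%g (PSL2_act g z) = PSL2_act g z.
  by rewrite -PSL2_actM -mulgA mulVg mulg1 PSL2_actM hz.
split=> //; first by apply: (GM); [exact: GM|exact: GV].
split; last by exists (PSL2_act g z).
move=> e; apply: h1.
have -> : h = (g^-1 * (g * h * g^-1) * g)%g.
  by rewrite !mulgA mulVg mul1g -mulgA mulVg mulg1.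
by rewrite e mulg1 mulVg.
Qed.

(* With p = cos a and q = sin a, this is the rotation of angle 2 a about z. *)
Definition has_rotation G z (p q : R) := p ^+ 2 + q ^+ 2 = 1 /\
  exists2 M, G (toPSL2 M) & SL2_mx M = p *: 1%:M + q *: half_turn z.

Lemma has_rotation_elliptic G g z : G g -> g <> 1%g -> PSL2_act g z = z ->
  exists p q, q != 0 /\ has_rotation G z p q.
Proof.
move: g; apply: toPSL2_ind => M GM M1; rewrite PSL2_actE => /fixed_decomposition.
move=> [p [q [ME pq]]]; exists p, q; split; last by split => //; exists M.
(* If [q = 0] then [p] is 1 or -1, and both lifts give the identity of [PSL2]. *)
apply/eqP => q0; apply: M1; apply/toPSL2_eq.
move: pq ME; rewrite q0 expr0n addr0 scale0r addr0 => /eqP.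
rewrite sqrf_eq1 /eqpm => /orP[]/eqP-> ->; rewrite ?scale1r ?eqxx //.
by rewrite scaleN1r eqxx orbT.
Qed.

Lemma has_rotationN G z p q : has_rotation G z p q -> has_rotation G z (- p) (- q).
Proof.
move=> [pq [M GM ME]]; split; first by rewrite !sqrrN.
have dN : \det (- SL2_mx M) == 1.
  by rewrite -scaleN1r detZ (eqP (SL2_det M)) mulr1 sqrrN expr1n.
exists (MkSL2 dN); last by rewrite /= ME !scaleNr opprD.
suff -> : toPSL2 (MkSL2 dN) = toPSL2 M by [].
by apply/toPSL2_eq; rewrite /eqpm eqxx orbT.
Qed.

(** [half_turn z] squares to -1, so it plays the role of the imaginary unit and conjugation is
    inversion. *)
Lemma has_rotationV G z p q : is_subgroup G ->
  has_rotation G z p q -> has_rotation G z p (- q).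
Proof.
move=> [G1 GM GV] [pq [M GM' ME]]; split; first by rewrite sqrrN.
exists (M^-1)%g; first by rewrite -toPSL2V; exact: GV.
set X := p *: _ + _.
suff e : SL2_mx M *m X = 1%:M by rewrite /= -[RHS](mulKmx (SL2_unit M)) e mulmx1.
rewrite /X ME; case: z {ME X} => [[x y] /= y0].
by apply: matrix2P; rewrite mulmx2E !mxE /=; [rewrite -[RHS]pq| | |rewrite -[RHS]pq];
  field; rewrite gt_eqF.
Qed.

Lemma has_rotation_sq G z p q : is_subgroup G ->
  has_rotation G z p q -> has_rotation G z (2 * p ^+ 2 - 1) (2 * p * q).
Proof.
move=> [G1 GM GV] [pq [M GM' ME]].
have -> : 2 * p ^+ 2 - 1 = p ^+ 2 - q ^+ 2 by lra.
split.
  have -> : (p ^+ 2 - q ^+ 2) ^+ 2 + (2 * p * q) ^+ 2 = (p ^+ 2 + q ^+ 2) ^+ 2 by ring.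
  by rewrite pq expr1n.
exists (M * M)%g; first by rewrite -toPSL2M; exact: GM.
rewrite /= ME; case: z {ME} => [[x y] /= y0].
by apply: matrix2P; rewrite mulmx2E !mxE /=; field; rewrite gt_eqF.
Qed.

Lemma subgroup_expg G M n : is_subgroup G -> G (toPSL2 M) -> G (toPSL2 (M ^+ n)%g).
Proof.
move=> [G1 GM GV] GM'; elim: n => [|n IH]; first by rewrite expg0.
by rewrite expgS -toPSL2M; exact: GM.
Qed.

Definition closest G z w := [/\ elliptic_points G z, elliptic_points G w, z <> w &
  forall z' w', elliptic_points G z' -> elliptic_points G w' -> z' <> w' ->
    delta z w <= delta z' w'].

Lemma closest_sym G z w : closest G z w -> closest G w z.
Proof.
move=> [ez ew zw h]; split => //; first exact: nesym.
by move=> z' w' ? ? ?; rewrite delta_sym; exact: h.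
Qed.

Lemma displ_gap G z w M : is_subgroup G -> closest G z w -> G (toPSL2 M) ->
  displ M w = 0 \/ delta z w <= displ M w.
Proof.
move=> sG [ez ew zw h] GM; rewrite -delta_act.
have [e|ne] := pselect (w = SL2_act M w); last first.
  right; apply: h => //; rewrite -PSL2_actE.
  exact: elliptic_points_orbit.
by left; rewrite -e /delta !subrr expr0n addr0 mul0r.
Qed.

(** Apply the gap to the [n]-th power and divide by [delta z w]: what remains constrains the trace
    of [M]. The displacement assumed is that of a rotation about [z] with coefficient [q]. *)
Lemma cheb_gap G z w M (q : R) n : is_subgroup G -> closest G z w -> G (toPSL2 M) ->
  q != 0 -> displ M w = q ^+ 2 * (delta z w * (delta z w + 4)) ->
  cheb (\tr M) n = 0 \/ 1 <= cheb (\tr M) n ^+ 2 * (q ^+ 2 * (delta z w + 4)).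
Proof.
move=> sG cl GM q0 dM; case: n => [|n]; first by left.
have := displ_gap sG cl (subgroup_expg n.+1 sG GM).
have d0 : 0 < delta z w.
  rewrite lt_neqAle delta_ge0 andbT eq_sym; apply/eqP => /delta_eq0.
  by case: cl.
rewrite SL2_expg -scaleNr displ_lin dM; move: (cheb _ n.+1) (delta z w) d0 => c d d0.
have -> : c ^+ 2 * (q ^+ 2 * (d * (d + 4))) = d * (c ^+ 2 * (q ^+ 2 * (d + 4))) by ring.
move=> [|]; last by rewrite ler_pMr //; right.
have [->|c0] := eqVneq c 0; first by left.
have d4 : d + 4 != 0 by rewrite gt_eqF ?addr_gt0.
by move=> /eqP; rewrite (negPf (mulf_neq0 (lt0r_neq0 d0)
  (mulf_neq0 (expf_neq0 2 c0) (mulf_neq0 (expf_neq0 2 q0) d4)))).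
Qed.

Lemma rotation_gap G z w (p q : R) n : is_subgroup G -> closest G z w ->
  q != 0 -> has_rotation G z p q ->
  cheb (2 * p) n = 0 \/ 1 <= cheb (2 * p) n ^+ 2 * (q ^+ 2 * (delta z w + 4)).
Proof.
move=> sG cl q0 [pq [M GM ME]].
have -> : 2 * p = \tr M.
  rewrite ME mxtrace2; case: z {cl ME} => [[x y] /= y0].
  by rewrite !mxE /=; field; rewrite gt_eqF.
apply: (cheb_gap n sG cl GM q0).
by rewrite ME addrC displ_lin displ_half_turn.
Qed.

(** The second rotation fixes [w], so the product moves [w] exactly as the first one does; only the
    trace changes. *)
Lemma rotation_pair_gap G z w (p q p' q' t : R) n : is_subgroup G -> closest G z w ->
  q != 0 -> has_rotation G z p q -> has_rotation G w p' q' ->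
  t = 2 * p * p' - q * q' * (delta z w + 2) ->
  cheb t n = 0 \/ 1 <= cheb t n ^+ 2 * (q ^+ 2 * (delta z w + 4)).
Proof.
move=> sG cl q0 [pq [M GM ME]] [pq' [N GN NE]] tE.
have -> : t = \tr (M * N)%g by rewrite tE /= ME NE tr_half_turns.
have GMN : G (toPSL2 (M * N)%g) by rewrite -toPSL2M; case: sG => _ h _; exact: h.
apply: (cheb_gap n sG cl GMN q0).
rewrite -delta_act SL2_actM (act_half_turn_comb NE) delta_act ME addrC.
by rewrite displ_lin displ_half_turn.
Qed.

End gap.

(** * Traces of rotations compatible with the gap *)

Section trace_classification.
Set Implicit Arguments.
Unset Strict Implicit.
Variable R : realType.
Implicit Types x K f : R.

(** The factor [K] is absorbed once and for all, since [25 / 26] exceeds [19 / 20]. *)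
Let ge_of_mul f K : 1 <= K -> K <= 26 / 25 -> 1 <= f * K -> 19 / 20 <= f.
Proof.
move=> K1 K2 fK; rewrite leNgt; apply/negP => h.
have : 0 <= (19 / 20 - f) * K by apply: mulr_ge0; lra.
lra.
Qed.

(** With [x = 4 cos(a)^2] the bounded quantity is [4 sin(n a)^2], here for [n = 2]; it is small near
    the values of [x] for rotations of order [n], so each such estimate clears a neighborhood of
    them. *)
Let order2_gap x : 19 / 20 <= x * (4 - x) -> 1 / 4 <= x.
Proof.
move=> h; rewrite leNgt; apply/negP => xlt; have := sqr_ge0 (x - 1 / 4); lra.
Qed.

Let order3_gap x : 19 / 20 <= (x - 1) ^+ 2 * (4 - x) -> x <= 8 / 5 -> x <= 1 / 2.
Proof.
move=> h x1; rewrite leNgt; apply/negP => x2.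
have bound (a B : R) : 0 <= 4 - x -> (x - 1) ^+ 2 <= a -> 4 - x <= B ->
    a * B < 19 / 20 -> False.
  move=> x4 xa xB aB.
  have : (x - 1) ^+ 2 * (4 - x) <= a * B by apply: ler_pM; rewrite ?sqr_ge0.
  by move=> /(le_trans h) /le_lt_trans /(_ aB); rewrite ltxx.
have [y1|y1] := lerP x 1; [|have [y2|y2] := lerP x (3 / 2)].
- apply: (bound (1 / 4) (7 / 2)); try lra.
  have : 0 <= (1 - x) * (x - 1 / 2) by apply: mulr_ge0; lra.
  lra.
- apply: (bound (1 / 4) 3); try lra.
  have : 0 <= (3 / 2 - x) * (x - 1 / 2) by apply: mulr_ge0; lra.
  lra.
- apply: (bound (9 / 25) (5 / 2)); try lra.
  have : 0 <= (8 / 5 - x) * (x - 2 / 5) by apply: mulr_ge0; lra.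
  lra.
Qed.

Let order4_gap x : 8 / 5 <= x -> x <= 5 / 2 ->
  19 / 20 <= x * (x - 2) ^+ 2 * (4 - x) -> False.
Proof.
move=> x1 x2; have -> : x * (x - 2) ^+ 2 * (4 - x) = (4 - (x - 2) ^+ 2) * (x - 2) ^+ 2.
  by ring.
have : (x - 2) ^+ 2 <= 1 / 4.
  have : 0 <= (5 / 2 - x) * (x - 3 / 2) by apply: mulr_ge0; lra.
  lra.
move: (_ ^+ 2) => u u1 h.
have : 0 <= (1 / 4 - u) * (15 / 4 - u) by apply: mulr_ge0; lra.
lra.
Qed.

Let order5_gap x (lo hi S D : R) : 5 / 2 <= lo -> lo <= x -> x <= hi ->
  1 / 4 <= S -> hi * hi - 3 * hi + 1 <= S -> 4 - lo <= D -> 0 <= 4 - x ->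
  S * S * D < 19 / 20 ->
  19 / 20 <= (x * x - 3 * x + 1) ^+ 2 * (4 - x) -> False.
Proof.
move=> lo0 xlo xhi S0 hS hD x4 SD h.
have s1 : x * x - 3 * x + 1 <= S.
  have h1 : 0 <= (hi - x) * (hi + x - 3) by apply: mulr_ge0; lra.
  by clear -hS h1; lra.
have s2 : - S <= x * x - 3 * x + 1.
  have h1 : 0 <= (x - 5 / 2) * (x - 1 / 2) by apply: mulr_ge0; lra.
  by clear -S0 h1; lra.
have s3 : (x * x - 3 * x + 1) ^+ 2 <= S * S.
  have h1 : 0 <= (S - (x * x - 3 * x + 1)) * (S + (x * x - 3 * x + 1)).
    by apply: mulr_ge0; [clear -s1|clear -s2]; lra.
  by clear -h1; lra.
have s4 : (x * x - 3 * x + 1) ^+ 2 * (4 - x) <= S * S * D.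
  by apply: ler_pM; rewrite ?sqr_ge0 //; clear -xlo hD; lra.
by have := le_lt_trans (le_trans h s4) SD; rewrite ltxx.
Qed.

Let order5_gap_high x : 5 / 2 <= x -> x <= 61 / 20 ->
  19 / 20 <= (x * x - 3 * x + 1) ^+ 2 * (4 - x) -> 119 / 40 <= x.
Proof.
move=> x1 x2 h; rewrite leNgt; apply/negP => xlt.
have [y1|y1] := lerP x (14 / 5).
  by apply: (@order5_gap x (5 / 2) (14 / 5) (9 / 20) (3 / 2)); lra.
have [y2|y2] := lerP x (29 / 10).
  by apply: (@order5_gap x (14 / 5) (29 / 10) (3 / 4) (6 / 5)); lra.
have [y3|y3] := lerP x (59 / 20).
  by apply: (@order5_gap x (29 / 10) (59 / 20) (6 / 7) (11 / 10)); lra.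
by apply: (@order5_gap x (59 / 20) (119 / 40) (14 / 15) (21 / 20)); lra.
Qed.

Let order5_gap_low x : 1 / 4 <= x -> x <= 1 / 2 ->
  19 / 20 <= (x * x - 3 * x + 1) ^+ 2 * (4 - x) -> False.
Proof.
move=> x1 x2 h.
have s1 : (x * x - 3 * x + 1) <= 1 / 3.
  by have : 0 <= (x - 1 / 4) * (11 / 4 - x) by [apply: mulr_ge0; lra]; lra.
have s2 : - (1 / 3) <= (x * x - 3 * x + 1).
  by have : 0 <= (1 / 2 - x) * (5 / 2 - x) by [apply: mulr_ge0; lra]; lra.
have s3 : (x * x - 3 * x + 1) ^+ 2 <= 1 / 9.
  move: s1 s2; move: (x * x - 3 * x + 1) => u s1 s2.
  by have : 0 <= (1 / 3 - u) * (1 / 3 + u) by [apply: mulr_ge0; lra]; lra.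
have : (x * x - 3 * x + 1) ^+ 2 * (4 - x) <= 1 / 9 * 4.
  by apply: ler_pM; rewrite ?sqr_ge0 //; lra.
lra.
Qed.

Let order6_gap x : 119 / 40 <= x -> x <= 61 / 20 ->
  19 / 20 <= x * (x - 1) ^+ 2 * (x - 3) ^+ 2 * (4 - x) -> False.
Proof.
move=> x1 x2 h.
have h1 : (x - 3) ^+ 2 <= 1 / 100.
  by have : 0 <= (1 / 10 - (x - 3)) * (1 / 10 + (x - 3)) by [apply: mulr_ge0; lra]; lra.
have h2 : (x - 1) ^+ 2 <= 5.
  by have : 0 <= (11 / 5 - (x - 1)) * (11 / 5 + (x - 1)) by [apply: mulr_ge0; lra]; lra.
have h3 : 0 <= x * (4 - x) by apply: mulr_ge0; lra.
have h4 : x * (4 - x) <= 4 by have := sqr_ge0 (x - 2); lra.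
have h5 : (x - 1) ^+ 2 * (x - 3) ^+ 2 <= 5 * (1 / 100).
  by apply: ler_pM; rewrite ?sqr_ge0.
have : (x * (4 - x)) * ((x - 1) ^+ 2 * (x - 3) ^+ 2) <= 4 * (5 * (1 / 100)).
  by apply: ler_pM => //; rewrite mulr_ge0 ?sqr_ge0.
have -> : (x * (4 - x)) * ((x - 1) ^+ 2 * (x - 3) ^+ 2) =
  x * (x - 1) ^+ 2 * (x - 3) ^+ 2 * (4 - x) by ring.
by move=> /(le_trans h) {h h1 h2 h3 h4 h5}; lra.
Qed.

(* Here x = 4 cos(a)^2, and the n-th disjunction says that n a either is a
   multiple of pi or stays away from these multiples. *)
Lemma trace_sq_classification x K : 0 <= x -> 1 <= K -> K <= 26 / 25 ->
  1 <= (4 - x) * K ->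
  x = 0 \/ 1 <= x * (4 - x) * K ->
  x = 1 \/ 1 <= (x - 1) ^+ 2 * (4 - x) * K ->
  x = 0 \/ x = 2 \/ 1 <= x * (x - 2) ^+ 2 * (4 - x) * K ->
  x * x - 3 * x + 1 = 0 \/ 1 <= (x * x - 3 * x + 1) ^+ 2 * (4 - x) * K ->
  x = 0 \/ x = 1 \/ x = 3 \/ 1 <= x * (x - 1) ^+ 2 * (x - 3) ^+ 2 * (4 - x) * K ->
  [\/ x = 0, x = 1, x = 2 | x = 3 \/ x * x - 3 * x + 1 = 0].
Proof.
move=> x0 K1 K2 /(ge_of_mul K1 K2) h1.
case=> [->|/(ge_of_mul K1 K2)/order2_gap h2]; first by move=> *; apply: Or41.
case=> [->|/(ge_of_mul K1 K2) h3]; first by move=> *; apply: Or42.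
case=> [->|]; first by move=> *; apply: Or41.
case=> [->|/(ge_of_mul K1 K2) h4]; first by move=> *; apply: Or43.
case=> [|/(ge_of_mul K1 K2) h5]; first by move=> *; apply: Or44; right.
case=> [->|]; first by apply: Or41.
case=> [->|]; first by apply: Or42.
case=> [->|/(ge_of_mul K1 K2) h6]; first by apply: Or44; left.
(* With all exact roots gone, [x] lies between 1/4 and 61/20, and the neighborhoods for
   [n = 3, 5, 4, 6] cover this interval. *)
have x3 : x <= 61 / 20 by lra.
have [y1|y1] := lerP x (8 / 5).
  by have := order5_gap_low h2 (order3_gap h3 y1) h5.
have [y2|y2] := lerP x (5 / 2); first by have := order4_gap (ltW y1) y2 h4.
by have := order6_gap (order5_gap_high (ltW y2) x3 h5) x3 h6.
Qed.

End trace_classification.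

(** * Possible rotations about a point of a closest pair *)

Section small_distance.
Set Implicit Arguments.
Unset Strict Implicit.
Variable R : realType.
Implicit Types (z w : UHP R) (G : set (PSL2 R)).

Lemma chebE (t : R) : [/\ cheb t 1 = 1, cheb t 2 = t, cheb t 3 = t ^+ 2 - 1,
  cheb t 4 = t * (t ^+ 2 - 2) &
  cheb t 5 = t ^+ 2 * t ^+ 2 - 3 * t ^+ 2 + 1 /\
  cheb t 6 = t * ((t ^+ 2 - 1) * (t ^+ 2 - 3))].
Proof. by split; last split; rewrite /=; ring. Qed.

(** The powers 1 to 6 give the hypotheses of the classification with [K = 1 + delta z w / 4]. The
    values 0, 1, 2, 3 belong to orders 2, 3, 4, 6, and the roots of the quadratic to order 5. *)
Lemma rotation_angle G z w (p q : R) : is_subgroup G -> closest G z w ->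
  delta z w <= 1 / 40 -> q != 0 -> has_rotation G z p q ->
  let x := (2 * p) ^+ 2 in
  [\/ x = 0, x = 1, x = 2 | x = 3 \/ x * x - 3 * x + 1 = 0].
Proof.
move=> sG cl d1 q0 rot x; have d0 := delta_ge0 z w.
have gap n := rotation_gap n sG cl q0 rot.
case: rot => pq _; have [c1 c2 c3 c4 [c5 c6]] := chebE (2 * p).
have qE : q ^+ 2 * (delta z w + 4) = (4 - x) * ((delta z w + 4) / 4).
  have -> : q ^+ 2 = 1 - p ^+ 2 by lra.
  by rewrite /x; field.
have sqr0 (u : R) : u ^+ 2 = 0 -> u = 0 by move=> /eqP; rewrite sqrf_eq0 => /eqP.
have ge1_eq (a b : R) : 1 <= a -> a = b -> 1 <= b by move=> ? <-.
apply: (@trace_sq_classification _ x ((delta z w + 4) / 4)).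
- exact: sqr_ge0.
- lra.
- lra.
- have := gap 1%N; rewrite c1 qE expr1n mul1r => -[/eqP|//].
  by rewrite oner_eq0.
- have [e|h] := gap 2%N; [left|right].
    by rewrite /x -c2 e expr0n.
  by apply: (ge1_eq _ _ h); rewrite qE c2 /x; ring.
- have [e|h] := gap 3%N; [left|right].
    by apply/eqP; rewrite -subr_eq0 -c3 e.
  by apply: (ge1_eq _ _ h); rewrite qE c3 /x; ring.
- have [/eqP|h] := gap 4%N; last first.
    by right; right; apply: (ge1_eq _ _ h); rewrite qE c4 /x; ring.
  rewrite c4 mulf_eq0 => /orP[/eqP e|]; first by left; rewrite /x e expr0n.
  by rewrite subr_eq0 => /eqP; right; left.
- have [e|h] := gap 5%N; [left|right].
    by rewrite -e c5 /x; ring.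
  by apply: (ge1_eq _ _ h); rewrite qE c5 /x; ring.
- have [/eqP|h] := gap 6%N; last first.
    by do 3 right; apply: (ge1_eq _ _ h); rewrite qE c6 /x; ring.
  rewrite c6 mulf_eq0 => /orP[/eqP e|]; first by left; rewrite /x e expr0n.
  rewrite mulf_eq0 !subr_eq0 => /orP[/eqP e|/eqP e].
  + by right; left.
  + by right; right; left.
Qed.

(* p = cos (pi / 5) *)
Definition golden (p : R) := 0 < p /\ 4 * p ^+ 2 = 2 * p + 1.

(** Inversion changes the sign of [q] and the other lift changes both signs, so both can be
    chosen. *)
Lemma normalize_rotation G z (p q : R) : is_subgroup G -> q != 0 ->
  has_rotation G z p q ->
  exists p' q', [/\ 0 < q', 0 <= p', p' = `|p| & has_rotation G z p' q'].
Proof.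
move=> sG q0 rot.
have [q' [q'0 rot']] : exists q', 0 < q' /\ has_rotation G z `|p| q'.
  exists `|q|; split; first by rewrite normr_gt0.
  have rN : has_rotation G z (- p) q.
    by have := has_rotationN (has_rotationV sG rot); rewrite opprK.
  have rV := has_rotationV sG rot; have rVN := has_rotationN rot.
  by case: (ler0P p) => _; case: (ler0P q) => _.
by exists `|p|, q'; rewrite normr_ge0.
Qed.

(* Squaring turns orders 4 and 6 into orders 2 and 3. *)
Lemma rotation_square_pos G z (p q : R) : is_subgroup G -> q != 0 -> p != 0 ->
  has_rotation G z p q -> exists q', 0 < q' /\ has_rotation G z `|2 * p ^+ 2 - 1| q'.
Proof.
move=> sG q0 p0 /(has_rotation_sq sG) r.
have n0 : 2 * p * q != 0 by rewrite !mulf_neq0.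
by have [p' [q' [q'0 _ -> ?]]] := normalize_rotation sG n0 r; exists q'.
Qed.

Lemma rotation_cases G z w (p q : R) : is_subgroup G -> closest G z w ->
  delta z w <= 1 / 40 -> q != 0 -> has_rotation G z p q -> p != 0 ->
  exists p' q', [/\ 0 < q', has_rotation G z p' q' &
    [\/ p' = 1 / 2, golden p' | 0 < p' /\ p' ^+ 2 = 1 / 2]].
Proof.
move=> sG cl d1 q0 rot p0.
have := rotation_angle sG cl d1 q0 rot.
have np0 : 0 < `|p| by rewrite normr_gt0.
have np2 : `|p| ^+ 2 = p ^+ 2 by rewrite real_normK ?num_real.
have [p' [q' [q'0 _ p'E rot']]] := normalize_rotation sG q0 rot; subst p'.
have [q2 [q20 rot2]] := rotation_square_pos sG q0 p0 rot.
rewrite exprMn -np2 => -[x|x|x|[x|x]].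
- by have : 0 < `|p| ^+ 2 by [rewrite exprn_gt0]; lra.
- exists `|p|, q'; split => //; apply: Or31.
  have /eqP : (`|p| - 1 / 2) * (`|p| + 1 / 2) = 0 by lra.
  by rewrite mulf_eq0 => /orP[/eqP|/eqP]; lra.
- by exists `|p|, q'; split => //; apply: Or33; split => //; lra.
- exists (1 / 2), q2; split => //; last exact: Or31.
  suff <- : `|2 * p ^+ 2 - 1| = 1 / 2 by [].
  by rewrite ger0_norm -np2; lra.
(* The first factor vanishes at [cos (pi / 5)], the second at [cos (2 pi / 5)]; in the second case
   squaring the rotation leads back to [cos (pi / 5)] up to sign. *)
- have /eqP : (4 * `|p| ^+ 2 - 2 * `|p| - 1) * (4 * `|p| ^+ 2 + 2 * `|p| - 1) = 0 by lra.
  rewrite mulf_eq0 => /orP[/eqP e|/eqP e].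
    by exists `|p|, q'; split => //; apply: Or32; split => //; lra.
  exists (`|2 * p ^+ 2 - 1|), q2; split => //; apply: Or32.
  have p1 : `|p| <= 1 / 2.
    rewrite leNgt; apply/negP => h.
    have : 0 < (`|p| - 1 / 2) * (`|p| + 1 / 2) by apply: mulr_gt0; lra.
    lra.
  have E : `|2 * p ^+ 2 - 1| = 1 / 2 + `|p| by rewrite ler0_norm -np2; lra.
  by rewrite E; split; lra.
Qed.

Lemma rotation_cases2 G z w : is_subgroup G -> closest G z w ->
  delta z w <= 1 / 40 ->
  exists p' q', [/\ 0 < q', has_rotation G z p' q' &
    [\/ p' = 1 / 2, golden p' | p' = 0]].
Proof.
move=> sG cl d1; have [[g [Gg [g1 _] gz]] _ _ _] := cl.
have [p [q [q0 rot]]] := has_rotation_elliptic Gg g1 gz.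
have [p0|p0] := eqVneq p 0.
  have [p' [q' [q'0 _ p'E rot']]] := normalize_rotation sG q0 rot.
  by exists p', q'; split => //; apply: Or33; rewrite p'E p0 normr0.
have [p' [q' [q'0 rot' c]]] := rotation_cases sG cl d1 q0 rot p0.
case: c => [c|c|[p'0 c]]; [by exists p', q'; split => //; apply: Or31|
  by exists p', q'; split => //; apply: Or32|].
have [q2 [q20 rot2]] := rotation_square_pos sG (lt0r_neq0 q'0) (lt0r_neq0 p'0) rot'.
exists 0, q2; split => //; last exact: Or33.
by move: rot2; rewrite c (_ : 2 * (1 / 2) - 1 = 0) ?normr0 //; lra.
Qed.

End small_distance.

(** * Excluding each pair of orders *)

Section order_pairs.
Set Implicit Arguments.
Unset Strict Implicit.
Variable R : realType.
Implicit Types (z w : UHP R) (G : set (PSL2 R)).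

Lemma golden_bounds (p : R) : golden p -> 4 / 5 < p /\ p < 81 / 100.
Proof.
move=> [p0 pE]; split; rewrite ltNge; apply/negP => h.
  have : 0 <= (4 / 5 - p) * p by apply: mulr_ge0; lra.
  lra.
have : 0 <= (p - 81 / 100) * p by apply: mulr_ge0; lra.
lra.
Qed.

Lemma golden_uniq (p p' : R) : golden p -> golden p' -> p = p'.
Proof.
move=> gp gp'; have [p1 _] := golden_bounds gp; have [p1' _] := golden_bounds gp'.
case: gp => _ pE; case: gp' => _ pE'.
have /eqP : (p - p') * (4 * (p + p') - 2) = 0 by lra.
rewrite mulf_eq0 subr_eq0 => /orP[/eqP//|/eqP]; lra.
Qed.

Lemma pos_sqr_inj (a b : R) : 0 < a -> 0 < b -> a ^+ 2 = b ^+ 2 -> a = b.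
Proof. by move=> a0 b0 /eqP; rewrite eqrXn2 ?ltW // => /eqP. Qed.

Let pow_lt1 (c B Q D : R) : 0 <= Q -> c ^+ 2 <= B -> Q <= D -> B * D < 1 ->
  1 <= c ^+ 2 * Q -> False.
Proof.
move=> Q0 cB QD BD h.
have : c ^+ 2 * Q <= B * D by apply: ler_pM => //; exact: sqr_ge0.
by move=> /(le_trans h) /le_lt_trans /(_ BD); rewrite ltxx.
Qed.

Let sqr_le (u U : R) : - U <= u -> u <= U -> u ^+ 2 <= U ^+ 2.
Proof.
move=> h1 h2; rewrite -subr_ge0 subr_sqr mulr_ge0 ?subr_ge0 //.
by rewrite -lerBlDl sub0r.
Qed.

Variables (G : set (PSL2 R)) (z w : UHP R).
Hypotheses (sG : is_subgroup G) (cl : closest G z w) (d40 : delta z w <= 1 / 40).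

Let d0 : 0 < delta z w.
Proof.
rewrite lt_neqAle delta_ge0 andbT eq_sym; apply/eqP => /delta_eq0.
by case: cl.
Qed.

Let d2 : 4 < (delta z w + 2) ^+ 2 /\ (delta z w + 2) ^+ 2 <= 411 / 100.
Proof.
move: d0 d40; move: (delta z w) => d h1 h2; split.
  by have : 0 <= d * d by [apply: mulr_ge0; lra]; lra.
by have : 0 <= (1 / 40 - d) * (1 / 40 + d) by [apply: mulr_ge0; lra]; lra.
Qed.

(** As [delta] tends to 0 the squared trace tends to 3, the Euclidean (2,3,6) case, so the sixth
    power nearly fixes [w]. It does not fix it, because [delta > 0] keeps the squared trace above
    3. *)
Lemma no_orders_3_2 (q q' : R) : 0 < q -> 0 < q' ->
  has_rotation G z (1 / 2) q -> has_rotation G w 0 q' -> False.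
Proof.
move=> q0 q0' rz rw.
have := rotation_pair_gap 6 sG cl (lt0r_neq0 q0) rz rw erefl.
have d00 := d0; have d41 := d40.
case: rz => qE _; case: rw => qE' _.
have [_ _ _ _ [_ ->]] := chebE (2 * (1 / 2) * 0 - q * q' * (delta z w + 2)).
have tE : (2 * (1 / 2) * 0 - q * q' * (delta z w + 2)) ^+ 2 = 3 / 4 * (delta z w + 2) ^+ 2.
  rewrite mulr0 sub0r sqrrN !exprMn.
  have -> : q ^+ 2 = 3 / 4 by lra.
  by have -> : q' ^+ 2 = 1 by [lra]; rewrite mulr1.
move: (2 * _ * 0 - _) tE => t tE.
have y1 : 3 < t ^+ 2 by rewrite tE; have [] := d2; lra.
have y2 : t ^+ 2 <= 31 / 10 by rewrite tE; have [] := d2; lra.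
have t0 : t != 0 by apply/eqP => t0; move: y1; rewrite t0 expr0n /=; lra.
case=> [/eqP|].
  by rewrite !mulf_eq0 (negPf t0) /= => /orP[/eqP|/eqP]; lra.
have -> : q ^+ 2 = 3 / 4 by lra.
apply: (@pow_lt1 _ (31 / 10 * ((21 / 10) ^+ 2 * (1 / 10) ^+ 2)) _ (31 / 10)); [lra| |lra|lra].
rewrite [(t * _) ^+ 2]exprMn [((_ - _) * _) ^+ 2]exprMn.
apply: ler_pM => //; [exact: sqr_ge0| |].
  by apply: mulr_ge0; exact: sqr_ge0.
by apply: ler_pM; [exact: sqr_ge0|exact: sqr_ge0| |]; apply: sqr_le; lra.
Qed.

(** The Euclidean (2,4,4) case: the squared trace is slightly above 2 and the fourth power is
    used. *)
Lemma no_orders_4_2 (p q q' : R) : 0 < q -> 0 < q' -> p ^+ 2 = 1 / 2 ->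
  has_rotation G z p q -> has_rotation G w 0 q' -> False.
Proof.
move=> q0 q0' pE rz rw.
have := rotation_pair_gap 4 sG cl (lt0r_neq0 q0) rz rw erefl.
have d00 := d0; have d41 := d40.
case: rz => qE _; case: rw => qE' _.
have [_ _ _ -> _] := chebE (2 * p * 0 - q * q' * (delta z w + 2)).
have tE : (2 * p * 0 - q * q' * (delta z w + 2)) ^+ 2 = 1 / 2 * (delta z w + 2) ^+ 2.
  rewrite mulr0 sub0r sqrrN !exprMn.
  have -> : q ^+ 2 = 1 / 2 by lra.
  by have -> : q' ^+ 2 = 1 by [lra]; rewrite mulr1.
move: (2 * _ * 0 - _) tE => t tE.
have y1 : 2 < t ^+ 2 by rewrite tE; have [] := d2; lra.
have y2 : t ^+ 2 <= 21 / 10 by rewrite tE; have [] := d2; lra.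
have t0 : t != 0 by apply/eqP => t0; move: y1; rewrite t0 expr0n /=; lra.
case=> [/eqP|].
  by rewrite !mulf_eq0 (negPf t0) /= => /eqP; lra.
have -> : q ^+ 2 = 1 / 2 by lra.
apply: (@pow_lt1 _ (21 / 10 * (1 / 10) ^+ 2) _ 3); [lra| |lra|lra].
rewrite [(t * _) ^+ 2]exprMn.
apply: ler_pM => //; [exact: sqr_ge0|exact: sqr_ge0|].
by apply: sqr_le; lra.
Qed.

Lemma golden_rotation_q (v : UHP R) (p q : R) : golden p -> has_rotation G v p q ->
  69 / 200 < q ^+ 2 /\ q ^+ 2 < 7 / 20.
Proof.
by move=> gp [qE _]; have := golden_bounds gp; case: gp => _ pE [p1 p2]; split; lra.
Qed.

(** The limiting squared trace is [4 sin(pi / 5)^2], about 1.38, so [cheb t 3 = t ^+ 2 - 1] is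
    nonzero yet small enough for the cube to violate the gap. *)
Lemma no_orders_5_2 (p q q' : R) : 0 < q -> 0 < q' -> golden p ->
  has_rotation G z p q -> has_rotation G w 0 q' -> False.
Proof.
move=> q0 q0' gp rz rw.
have := rotation_pair_gap 3 sG cl (lt0r_neq0 q0) rz rw erefl.
have d00 := d0; have d41 := d40.
have [qlo qhi] := golden_rotation_q gp rz.
case: rw => qE' _.
have [_ _ -> _ _] := chebE (2 * p * 0 - q * q' * (delta z w + 2)).
have tE : (2 * p * 0 - q * q' * (delta z w + 2)) ^+ 2 = q ^+ 2 * (delta z w + 2) ^+ 2.
  rewrite mulr0 sub0r sqrrN !exprMn.
  by have -> : q' ^+ 2 = 1 by [lra]; rewrite mulr1.
move: (2 * _ * 0 - _) (q ^+ 2) qlo qhi tE => t Q qlo qhi tE.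
have [/ltW s1 s2] := d2.
have y1 : 69 / 200 * 4 <= t ^+ 2 by rewrite tE; apply: ler_pM; lra.
have y2 : t ^+ 2 <= 7 / 20 * (411 / 100).
  by rewrite tE; apply: ler_pM; rewrite ?sqr_ge0 //; lra.
case=> [|]; first lra.
apply: (@pow_lt1 _ ((1 / 2) ^+ 2) _ (7 / 20 * 5)); [|by apply: sqr_le; lra| |lra].
  by apply: mulr_ge0; lra.
by apply: ler_pM; lra.
Qed.

(** The Euclidean (3,3,3) case: the trace is slightly below -1 and the cube is used. *)
Lemma no_orders_3_3 (q q' : R) : 0 < q -> 0 < q' ->
  has_rotation G z (1 / 2) q -> has_rotation G w (1 / 2) q' -> False.
Proof.
move=> q0 q0' rz rw.
have := rotation_pair_gap 3 sG cl (lt0r_neq0 q0) rz rw erefl.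
have d00 := d0; have d41 := d40.
case: rz => qE _; case: rw => qE' _.
have e : q = q' by apply: pos_sqr_inj => //; lra.
rewrite -e -expr2; have -> : q ^+ 2 = 3 / 4 by lra.
have [_ _ -> _ _] := chebE (2 * (1 / 2) * (1 / 2) - 3 / 4 * (delta z w + 2)).
have -> : 2 * (1 / 2) * (1 / 2) - 3 / 4 * (delta z w + 2) = - (1 + 3 / 4 * delta z w).
  by field.
rewrite sqrrN; move: d00 d40; move: (delta z w) => d h1 h2.
case=> [|]; first nra.
by apply: (@pow_lt1 _ ((1 / 10) ^+ 2) _ 4); [lra|apply: sqr_le; nra|lra|lra].
Qed.

(** The trace is near [2 cos (pi / 5 + pi / 3)], about -0.21, so the product is close to a half-turn
    and its square violates the gap. *)
Lemma no_orders_5_3 (p q q' : R) : 0 < q -> 0 < q' -> golden p ->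
  has_rotation G z p q -> has_rotation G w (1 / 2) q' -> False.
Proof.
move=> q0 q0' gp rz rw.
have := rotation_pair_gap 2 sG cl (lt0r_neq0 q0) rz rw erefl.
have d00 := d0; have d41 := d40.
have [qlo qhi] := golden_rotation_q gp rz.
case: rw => qE' _; have [p1 p2] := golden_bounds gp.
have [_ -> _ _ _] := chebE (2 * p * (1 / 2) - q * q' * (delta z w + 2)).
have sE : (q * q') ^+ 2 = 3 / 4 * q ^+ 2.
  by rewrite exprMn (_ : q' ^+ 2 = 3 / 4) 1?mulrC //; lra.
have s0 : 0 < q * q' by exact: mulr_gt0.
have s1 : 1 / 2 <= q * q'.
  rewrite leNgt; apply/negP => h.
  have : (q * q') ^+ 2 <= (1 / 2) ^+ 2 by apply: sqr_le; lra.
  lra.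
have s2 : q * q' <= 52 / 100.
  rewrite leNgt; apply/negP => h.
  have : (52 / 100) ^+ 2 <= (q * q') ^+ 2 by apply: sqr_le; lra.
  lra.
move: (q * q') (q ^+ 2) sE s1 s2 s0 qlo qhi => s Q sE s1 s2 s0 qlo qhi.
have h1 : 1 / 2 * 2 <= s * (delta z w + 2) by apply: ler_pM; lra.
have h2 : s * (delta z w + 2) <= 52 / 100 * (81 / 40) by apply: ler_pM; lra.
case=> [|]; first lra.
apply: (@pow_lt1 _ ((1 / 2) ^+ 2) _ (7 / 20 * 5)); [|by apply: sqr_le; lra| |lra].
  by apply: mulr_ge0; lra.
by apply: ler_pM; lra.
Qed.

(** The trace is near [2 cos (2 pi / 5)], about 0.62, and the square again suffices. *)
Lemma no_orders_5_5 (p q p' q' : R) : 0 < q -> 0 < q' -> golden p -> golden p' ->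
  has_rotation G z p q -> has_rotation G w p' q' -> False.
Proof.
move=> q0 q0' gp gp' rz rw.
have := rotation_pair_gap 2 sG cl (lt0r_neq0 q0) rz rw erefl.
have d00 := d0; have d41 := d40.
have [qlo qhi] := golden_rotation_q gp rz; have [p1 p2] := golden_bounds gp.
have pp := golden_uniq gp gp'; subst p'.
have e : q = q'.
  by apply: pos_sqr_inj => //; case: rz => ? _; case: rw => ? _; lra.
have [_ -> _ _ _] := chebE (2 * p * p - q * q' * (delta z w + 2)).
rewrite -e -expr2.
have -> : 2 * p * p = p + 1 / 2 by case: gp => _; lra.
move: (q ^+ 2) qlo qhi => Q qlo qhi.
have h1 : 69 / 200 * 2 <= Q * (delta z w + 2) by apply: ler_pM; lra.
have h2 : Q * (delta z w + 2) <= 7 / 20 * (81 / 40) by apply: ler_pM; lra.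
case=> [|]; first lra.
apply: (@pow_lt1 _ ((5 / 8) ^+ 2) _ (7 / 20 * (161 / 40))); [|by apply: sqr_le; lra| |lra].
  by apply: mulr_ge0; lra.
by apply: ler_pM; lra.
Qed.

End order_pairs.

(** * Rotations about a closest pair are half-turns *)

Section large_order.
Set Implicit Arguments.
Unset Strict Implicit.
Variable R : realType.
Implicit Types (z w : UHP R) (G : set (PSL2 R)).

(** Otherwise the rotation about [z] reduces to order 3, 5 or 4 and one about [w] to order 3, 5 or
    2; all nine combinations are impossible. *)
Lemma closest_half_turns G z w (p q : R) : is_subgroup G -> closest G z w ->
  delta z w <= 1 / 40 -> q != 0 -> has_rotation G z p q -> p = 0.
Proof.
move=> sG cl d1 q0 rot; apply/eqP; apply/negPn/negP => p0.
have cl' := closest_sym cl; have d1' : delta w z <= 1 / 40 by rewrite delta_sym.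
have [p1 [q1 [q10 rz c]]] := rotation_cases sG cl d1 q0 rot p0.
have [p2 [q2 [q20 rw c']]] := rotation_cases2 sG cl' d1'.
case: c => [e|g|[p10 e]]; case: c' => [e'|g'|e']; subst.
- exact: (no_orders_3_3 sG cl d1 q10 q20 rz rw).
- exact: (no_orders_5_3 sG cl' d1' q20 q10 g' rw rz).
- exact: (no_orders_3_2 sG cl d1 q10 q20 rz rw).
- exact: (no_orders_5_3 sG cl d1 q10 q20 g rz rw).
- exact: (no_orders_5_5 sG cl d1 q10 q20 g g' rz rw).
- exact: (no_orders_5_2 sG cl d1 q10 q20 g rz rw).
(* Order 4 against order 3 or 5: square the former to a half-turn and exchange the roles of [z] and
   [w]. *)
- have [q3 [q30 rz2]] := rotation_square_pos sG (lt0r_neq0 q10) (lt0r_neq0 p10) rz.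
  have e0 : `|2 * p1 ^+ 2 - 1| = 0 by rewrite e (_ : 2 * (1 / 2) - 1 = 0) ?normr0 //; lra.
  by rewrite e0 in rz2; exact: (no_orders_3_2 sG cl' d1' q20 q30 rw rz2).
- have [q3 [q30 rz2]] := rotation_square_pos sG (lt0r_neq0 q10) (lt0r_neq0 p10) rz.
  have e0 : `|2 * p1 ^+ 2 - 1| = 0 by rewrite e (_ : 2 * (1 / 2) - 1 = 0) ?normr0 //; lra.
  by rewrite e0 in rz2; exact: (no_orders_5_2 sG cl' d1' q20 q30 g' rw rz2).
- exact: (no_orders_4_2 sG cl d1 q10 q20 e rz rw).
Qed.

End large_order.

(** * Translation lengths, stabilizers and the final bounds *)

Section conclusion.
Set Implicit Arguments.
Unset Strict Implicit.
Variable R : realType.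
Implicit Types (z w : UHP R) (G : set (PSL2 R)) (M N : SL2 R).

Definition mx2 (a b c e : R) : 'M[R]_2 :=
  \matrix_(i, j) (if i == 0 then if j == 0 then a else b
                  else if j == 0 then c else e).

Lemma det_mx2 (a b c e : R) : \det (mx2 a b c e) = a * e - b * c.
Proof.
rewrite (expand_det_row _ 0) !big_ord_recl big_ord0 /cofactor !det_mx11 !mxE /=.
by rewrite expr0 expr1 mul1r mulN1r addr0 mulrN.
Qed.

Lemma SL2_of (a b c e : R) : a * e - b * c = 1 -> exists M, SL2_mx M = mx2 a b c e.
Proof. by rewrite -det_mx2 => /eqP d; exists (MkSL2 d). Qed.

Lemma toPSL2N M N : SL2_mx N = - SL2_mx M -> toPSL2 N = toPSL2 M.
Proof. by move=> NM; apply/toPSL2_eq; rewrite /eqpm NM eqxx orbT. Qed.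

Lemma diagonalization M (l m : R) : l * m = 1 -> l != m -> \tr M = l + m ->
  exists H D, SL2_mx D = mx2 l 0 0 m /\ M = (H * D * H^-1)%g.
Proof.
move=> lm nlm; rewrite mxtrace2 => trM; have dM := SL2_detE M.
have [|D DE] := @SL2_of l 0 0 m; first by rewrite mulr0 subr0.
have lm0 : l - m != 0 by rewrite subr_eq0.
suff [H HE] : exists H : SL2 R, SL2_mx M *m SL2_mx H = SL2_mx H *m SL2_mx D.
  exists H, D; split => //.
  have : (M * H)%g = (H * D)%g by exact: val_inj.
  by move=> <-; rewrite -mulgA mulgV mulg1.
have eE : M 1 1 = l + m - M 0 0 by rewrite -trM; ring.
have [c0|c0] := eqVneq (M 1 0) 0; last first.
  (* The columns are eigenvectors for [l] and [m], the first one scaled to make the determinant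
     1. *)
  have [|H HE] := @SL2_of ((l - M 1 1) / (M 1 0 * (l - m))) (m - M 1 1) (l - m)^-1 (M 1 0).
    by field; rewrite c0 lm0.
  exists H; rewrite DE HE; apply: matrix2P; rewrite !mulmx2E !mxE /=.
  - have -> : M 0 1 = (M 0 0 * M 1 1 - l * m) / M 1 0 by rewrite lm -dM; field.
    by rewrite eE; field; rewrite c0 lm0.
  - have -> : M 0 1 = (M 0 0 * M 1 1 - l * m) / M 1 0 by rewrite lm -dM; field.
    by rewrite eE; field; rewrite ?c0 ?lm0.
  - by rewrite eE; field; rewrite c0 lm0.
  - by rewrite eE; ring.
have : (M 0 0 - l) * (M 0 0 - m) = 0.
  have -> : (M 0 0 - l) * (M 0 0 - m) = l * m - M 0 0 * (l + m - M 0 0) by ring.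
  by rewrite -eE lm -dM c0; ring.
move/eqP; rewrite mulf_eq0 !subr_eq0 => /orP[/eqP a0|/eqP a0].
  have [|H HE] := @SL2_of 1 (M 0 1 / (m - l)) 0 1; first by ring.
  exists H; rewrite DE HE; apply: matrix2P; rewrite !mulmx2E !mxE /= ?c0 ?eE ?a0;
    by field; rewrite -?(opprB l) ?oppr_eq0 ?lm0.
have [|H HE] := @SL2_of (M 0 1 / (l - m)) (-1) 1 0; first by ring.
exists H; rewrite DE HE; apply: matrix2P; rewrite !mulmx2E !mxE /= ?c0 ?eE ?a0;
  by field; rewrite ?lm0.
Qed.

Lemma diagonal_act (D : SL2 R) (l m : R) z : l * m = 1 -> SL2_mx D = mx2 l 0 0 m ->
  UHP_val (PSL2_act (toPSL2 D) z) = (l ^+ 2)%:C%C * UHP_val z.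
Proof.
move=> lm DE; rewrite PSL2_actE /= /moebius /moebius_num /moebius_den DE !mxE /=.
have m0 : m%:C%C != 0 :> R[i].
  by apply/eqP => -[m0]; move: lm; rewrite m0 mulr0 => /eqP; rewrite eq_sym oner_eq0.
rewrite !rmorph0 mul0r addr0 add0r; apply: (mulIf m0); rewrite divfK //.
rewrite mulrAC -rmorphM /= (_ : l ^+ 2 * m = l) //.
by rewrite expr2 -mulrA lm mulr1.
Qed.

(** The opposite lift has eigenvalues [expR d] and [expR (- d)], so in suitable coordinates it
    multiplies by [expR d ^+ 2]. *)
Lemma hyperbolic_translation_length M (d : R) : 0 < d ->
  \tr M = - (expR d + expR (- d)) -> translation_length (toPSL2 M) (2 * d).
Proof.
move=> d0 trM; have dN : \det (- SL2_mx M) == 1.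
  by rewrite -scaleN1r detZ (eqP (SL2_det M)) mulr1 sqrrN expr1n.
pose M' := MkSL2 dN.
have lm : expR d * expR (- d) = 1 by exact: expRxMexpNx_1.
have l1 : 1 < expR d by rewrite expR_gt1.
have [||H [D [DE ME]]] := @diagonalization M' (expR d) (expR (- d)) lm.
- by rewrite gt_eqF // ltr_expR; lra.
- by rewrite /= raddfN /= trM opprK.
exists (expR d ^+ 2), (toPSL2 H), (toPSL2 D); split.
- by rewrite expr_gt1 // ltW.
- by move=> z; exact: diagonal_act lm DE.
- have -> : toPSL2 M = toPSL2 M' by apply/esym/toPSL2N.
  by rewrite ME -!toPSL2M -toPSL2V.
- by rewrite lnXn ?expR_gt0 // expRK mulr_natl.
Qed.

Lemma closest_of_elliptic_pair G z w : closest_elliptic_pair G z w -> closest G z w.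
Proof.
move=> [ez ew zw h]; split => // z' w' ez' ew' zw'.
by apply: rho_monotone; exact: h.
Qed.

Lemma sinh_le (a b : R) : a <= b -> sinh a <= sinh b.
Proof.
move=> ab; rewrite /sinh ler_pM2r //; apply: lerB; rewrite ler_expR //.
by rewrite lerN2.
Qed.

(** Here [delta z w * (delta z w + 4)] is at most [16 / 3 * Cconst R ^+ 2], and [Cconst R < 2 / 15]
    makes this less than its value at [delta = 1 / 40]. *)
Lemma delta_small z w : rho z w < kappa R -> delta z w <= 1 / 40.
Proof.
move=> /ltW /sinh_le; rewrite /kappa arsinhK.
have /andP[C1 C2] := Cconst_bounds R; have [r0 _] := rho_delta z w.
have := delta_sinh z w; have := delta_ge0 z w; move: (delta z w) => d d0 dE sle.
have s0 : 0 <= sinh (rho z w).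
  by have := sinh_le r0; rewrite {1}/sinh oppr0 subrr mul0r.
have sq : sinh (rho z w) ^+ 2 <= 4 / 3 * Cconst R ^+ 2.
  have -> : 4 / 3 * Cconst R ^+ 2 = (2 / Num.sqrt 3 * Cconst R) ^+ 2.
    have s3 : Num.sqrt (3 : R) ^+ 2 = 3 by rewrite sqr_sqrtr.
    by rewrite exprMn expr_div_n s3; field.
  by rewrite lerXn2r ?nnegrE // (le_trans s0).
have C3 : Cconst R ^+ 2 <= (2 / 15) ^+ 2 by rewrite lerXn2r ?nnegrE //; lra.
rewrite leNgt; apply/negP => h.
have : 0 <= (d - 1 / 40) * (d + 4) by apply: mulr_ge0; lra.
lra.
Qed.

Lemma systole_le G z w : is_subgroup G -> closest G z w -> delta z w <= 1 / 40 ->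
  (systole G <= (2 * rho z w)%:E)%E.
Proof.
move=> sG cl d1; have [[g [Gg [g1 _] gz]] [h [Gh [h1 _] hw]] zw _] := cl.
have [p [q [q0 rz]]] := has_rotation_elliptic Gg g1 gz.
have [p' [q' [q'0 rw]]] := has_rotation_elliptic Gh h1 hw.
have p0 := closest_half_turns sG cl d1 q0 rz.
have d1' : delta w z <= 1 / 40 by rewrite delta_sym.
have p'0 := closest_half_turns sG (closest_sym cl) d1' q'0 rw.
(* Normalizing the lifts to be the half-turn matrices themselves fixes the sign of the trace of
   their product. *)
have unit_rot v (a b : R) : b != 0 -> has_rotation G v a b -> a = 0 -> has_rotation G v 0 1.
  move=> b0 rv a0; have [a' [b' [b'0 _ a'E rv']]] := normalize_rotation sG b0 rv.
  move: rv'; rewrite a'E a0 normr0 => rv'; have [bE _] := rv'.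
  suff -> : 1 = b' by [].
  by apply: pos_sqr_inj => //; rewrite expr1n; lra.
have [_ [M GM ME]] := unit_rot z p q q0 rz p0.
have [_ [N GN NE]] := unit_rot w p' q' q'0 rw p'0.
apply: ereal_inf_lbound; exists (2 * rho z w) => //.
exists (toPSL2 (M * N)%g); first by rewrite -toPSL2M; case: sG => _ GMul _; exact: GMul.
have [r0 rE] := rho_delta z w.
apply: hyperbolic_translation_length.
  rewrite lt_neqAle r0 andbT eq_sym; apply/eqP => e; apply: zw; apply: delta_eq0.
  by rewrite -rE e oppr0 expR0; ring.
rewrite /= ME NE tr_half_turns -rE; ring.
Qed.

(** Every nontrivial element fixing [z] lifts to [half_turn z] up to sign, hence there is only one
    in [PSL2]. *)
Lemma point_order_le2 G z w : is_subgroup G -> closest G z w -> delta z w <= 1 / 40 ->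
  (point_order G z <= 2)%N.
Proof.
move=> sG cl d1; have [[g0 [Gg0 [g01 _] g0z]] _ _ _] := cl.
have sub : stabilizer G z `<=` [set 1%g; g0].
  move=> g [Gg gz]; have [->|/eqP g1] := eqVneq g 1%g; [by left|right].
  move: g g0 g1 g01 Gg Gg0 gz g0z; apply: toPSL2_ind => M; apply: toPSL2_ind => N.
  move=> M1 N1 GM GN; rewrite !PSL2_actE => fM fN; apply/toPSL2_eq.
  have form A : toPSL2 A <> 1%g -> G (toPSL2 A) -> SL2_act A z = z ->
      exists2 q, SL2_mx A = q *: half_turn z & q ^+ 2 = 1.
    move=> A1 GA fA; have [p [q [AE pq]]] := fixed_decomposition fA.
    have rA : has_rotation G z p q by split => //; exists A.
    have q0 : q != 0.
      apply/eqP => q0; apply: A1; apply/toPSL2_eq.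
      move: pq AE; rewrite q0 expr0n addr0 scale0r addr0 => /eqP.
      rewrite sqrf_eq1 /eqpm => /orP[]/eqP-> ->; rewrite ?scale1r ?eqxx //.
      by rewrite scaleN1r eqxx orbT.
    have p0 := closest_half_turns sG cl d1 q0 rA.
    by exists q; rewrite ?AE ?p0 ?scale0r ?add0r // -pq p0 expr0n add0r.
  have [a MA a1] := form M M1 GM fM; have [b NB b1] := form N N1 GN fN.
  rewrite /eqpm MA NB -scaleNr.
  have /eqP : a ^+ 2 = b ^+ 2 by rewrite a1 b1.
  by rewrite eqf_sqr => /orP[]/eqP->; rewrite eqxx ?orbT.
have fin : finite_set (stabilizer G z) by apply: sub_finite_set sub _; exact: finite_set2.
rewrite /point_order.
have sub' : (fset_set (stabilizer G z) `<=` [fset 1%g; g0])%fset.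
  apply/fsubsetP => g; rewrite in_fset_set // => /set_mem /sub gE.
  by rewrite in_fset2; case: gE => ->; rewrite eqxx ?orbT.
apply: leq_trans (fsubset_leq_card sub') _.
by rewrite cardfs2; case: (_ == _).
Qed.

End conclusion.

Theorem mainTheorem1 (R : realType) (G : set (PSL2 R)) (z w : UHP R) :
  Fuchsian G -> geometrically_finite G ->
  closest_elliptic_pair G z w ->
  [/\ (mine (systole G * (2^-1)%:E) (kappa R)%:E <= (rho z w)%:E)%E,
      (forall p, elliptic_points G p -> (2 < point_order G p)%N) ->
        kappa R <= rho z w,
      151 / 1000 <= kappa R < 152 / 1000
    & 1318 / 10000 <= Cconst R < 1319 / 10000].
Proof.
move=> [sG _] _ /closest_of_elliptic_pair cl; split.
(* Below [kappa], both points carry only half-turns, and their product bounds the systole by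
   [2 * rho z w]. *)
- have [k|/delta_small d1] := lerP (kappa R) (rho z w).
    by rewrite ge_min lee_fin k orbT.
  rewrite ge_min; apply/orP; left.
  apply: le_trans (lee_wpmul2r _ (systole_le sG cl d1)) _.
    by rewrite lee_fin invr_ge0.
  by rewrite -EFinM lee_fin mulrAC divff ?mul1r.
- move=> ord; rewrite leNgt; apply/negP => /delta_small d1.
  have [ez _ _ _] := cl; have := ord z ez.
  by rewrite ltnNge (point_order_le2 sG cl d1).
- exact: kappa_bounds.
- have dec (n : nat) : n%:R / 10000 = n%:R / 10 / 1000 :> R.
    have -> : 10000 = 10 * 1000 :> R by rewrite -natrM.
    by rewrite invfM mulrA.
  have /andP[lo hi] := Cconst_bounds R; rewrite !dec.
  have -> : 1318 / 10 = 131 + 8 / 10 :> R by lra.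
  have -> : 1319 / 10 = 131 + 9 / 10 :> R by lra.
  by rewrite lo hi.
Qed.
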